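(* Let $X\subset\mathbb{R}^d$ be relatively separated and let $\mathcal{H}$ be a complex Hilbert space. For every $s>d$, the Jaffard algebra $(\mathcal{J}_s,|\|\cdot\||_{\mathcal{J}_s})$, $\mathcal{J}_s=\mathcal{J}_s(X;\mathcal{B}(\mathcal{H}))$, is inverse-closed in $\mathcal{B}(\ell^2(X;\mathcal{H}))$; that is, if $A\in\mathcal{J}_s$ is invertible in $\mathcal{B}(\ell^2(X;\mathcal{H}))$, then $A^{-1}\in\mathcal{J}_s$. In particular, for every $s>d$, $(\mathcal{J}_s,|\|\cdot\||_{\mathcal{J}_s})$ is a symmetric Banach algebra, i.e. the spectrum $\sigma_{\mathcal{J}_s}(A^*A)$ of $A^*A$ in the algebra $\mathcal{J}_s$ is contained in $[0,\infty)$ for all $A\in\mathcal{J}_s$.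
   Context: A set $X\subset\mathbb{R}^d$ is relatively separated if $\sup_{x\in\mathbb{R}^d}|X\cap(x+[0,1]^d)|<\infty$ (where $|\cdot|$ of a set is its cardinality). $\mathcal{B}(E)$ denotes the bounded linear operators on $E$. $\ell^2(X;\mathcal{H})$ is the Hilbert space of families $(g_l)_{l\in X}$ in $\mathcal{H}$ with $\sum_{l\in X}\|g_l\|^2<\infty$. For $s\ge 0$ let $\nu_s(x)=(1+|x|)^s$, $x\in\mathbb{R}^d$, with $|x|$ the Euclidean norm. $\mathcal{J}_s=\mathcal{J}_s(X;\mathcal{B}(\mathcal{H}))$ is the space of all $\mathcal{B}(\mathcal{H})$-valued matrices $A=[A_{k,l}]_{k,l\in X}$ with $\|A\|_{\mathcal{J}_s}:=\sup_{k,l\in X}\|A_{k,l}\|\,\nu_s(k-l)<\infty$. For $s>d$ it is an algebra under matrix multiplication $[A\cdot B]_{k,l}=\sum_{n\in X}A_{k,n}B_{n,l}$, with unit the diagonal matrix having the identity of $\mathcal{B}(\mathcal{H})$ on the diagonal, and with involution $[A^*]_{k,l}=(A_{l,k})^*$. It is equipped with the norm $|\|A\||_{\mathcal{J}_s}:=\sup\{\|A\cdot B\|_{\mathcal{J}_s}: B\in\mathcal{J}_s,\ \|B\|_{\mathcal{J}_s}=1\}$, which is equivalent to $\|\cdot\|_{\mathcal{J}_s}$. A matrix $A\in\mathcal{J}_s$ ($s>d$) is identified with the bounded operator on $\ell^2(X;\mathcal{H})$ given by $(Ag)_k=\sum_{l\in X}A_{k,l}g_l$; conversely every operator in $\mathcal{B}(\ell^2(X;\mathcal{H}))$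 is uniquely identified with a $\mathcal{B}(\mathcal{H})$-valued matrix acting by this formula, composition of operators corresponding to the matrix multiplication $[A\cdot B]_{k,l}=\sum_{n\in X}A_{k,n}B_{n,l}$ and adjoints corresponding to the involution $[A^*]_{k,l}=(A_{l,k})^*$. *)

(* Defs.v *)
From HB Require Import structures.
From mathcomp Require Import all_boot all_order all_algebra complex.
From mathcomp Require Import all_classical all_reals all_analysis.
From mathcomp Require Import ring lra.
From mathcomp.analysis.showcase Require summability.

Set Implicit Arguments.
Unset Strict Implicit.
Unset Printing Implicit Defensive.

Import Order.TTheory GRing.Theory Num.Theory.
Import numFieldNormedType.Exports.

Local Open Scope classical_set_scope.
Local Open Scope ring_scope.
Local Open Scope complex_scope.

(* In a normedModType R[i] the norm takes its values in R[i]. *)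
Definition rnorm {R : realType} {V : normedModType R[i]} (x : V) : R :=
  complex.Re `|x|.

Lemma Re_norm_ge0 {R : realType} (a : R[i]) : 0 <= complex.Re `|a|.
Proof. by rewrite -ler0c RRe_real // ger0_real. Qed.

Lemma normCE {R : realType} (a : R[i]) : `|a| = (complex.Re `|a|)%:C.
Proof. by rewrite RRe_real // ger0_real. Qed.

Lemma Re_norm_gt0 {R : realType} (a : R[i]) : a != 0 -> 0 < complex.Re `|a|.
Proof.
move=> a0; rewrite lt0r Re_norm_ge0 andbT; apply: contraNneq a0 => e.
by rewrite -normr_eq0 normCE e.
Qed.

Lemma Re_normV {R : realType} (a : R[i]) :
  complex.Re `|a|^-1 = (complex.Re `|a|)^-1.
Proof. by rewrite [in LHS]normCE -fmorphV. Qed.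

Lemma real_complexM {R : realType} (x y : R) : (x * y)%:C = x%:C * y%:C.
Proof. exact: rmorphM. Qed.

Lemma real_complexD {R : realType} (x y : R) : (x + y)%:C = x%:C + y%:C.
Proof. exact: rmorphD. Qed.

Section rnorm_theory.
Context {R : realType} {V : normedModType R[i]}.
Implicit Types x y : V.

Lemma rnormE x : `|x| = (rnorm x)%:C.
Proof. by rewrite /rnorm RRe_real // ger0_real. Qed.

Lemma rnorm_ge0 x : 0 <= rnorm x.
Proof. by rewrite -ler0c -rnormE. Qed.

Lemma rnorm0 : rnorm (0 : V) = 0.
Proof. by rewrite /rnorm normr0. Qed.

Lemma rnorm0_eq0 x : rnorm x = 0 -> x = 0.
Proof. by move=> x0; apply/normr0_eq0; rewrite rnormE x0. Qed.

Lemma ler_rnormD x y : rnorm (x + y) <= rnorm x + rnorm y.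
Proof. by rewrite -lecR real_complexD -!rnormE; exact: ler_normD. Qed.

Lemma rnormZ (a : R[i]) x : rnorm (a *: x) = complex.Re `|a| * rnorm x.
Proof. by apply: (@complexI R); rewrite real_complexM -normCE -!rnormE normrZ. Qed.

End rnorm_theory.

Section bounded_operators.
Context {R : realType} (V W : normedModType R[i]).

Definition bounded_linear : {pred V -> W} := fun f =>
  `[< linear f /\ exists M : R, forall x, rnorm (f x) <= M * rnorm x >].

Record bop := Bop { bop_fun :> V -> W; _ : bop_fun \in bounded_linear }.

HB.instance Definition _ := [isSub for bop_fun].
HB.instance Definition _ := [Choice of bop by <:].

Lemma bounded_linearP f : reflect
  (linear f /\ exists M : R, forall x, rnorm (f x) <= M * rnorm x)
  (f \in bounded_linear).
Proof. exact: asboolP. Qed.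

Lemma bopP (f : bop) :
  linear f /\ exists M : R, forall x, rnorm (f x) <= M * rnorm x.
Proof. exact/bounded_linearP/valP. Qed.

Lemma bounded_linear_submod_closed : submod_closed bounded_linear.
Proof.
split.
  apply/bounded_linearP; split.
    by move=> a x y; rewrite /GRing.zero/= scaler0 addr0.
  by exists 0 => x; rewrite mul0r /= rnorm0.
move=> a f g /bounded_linearP[lf [M fM]] /bounded_linearP[lg [N gN]].
apply/bounded_linearP; split.
  move=> b x y.
  have E z : (a *: f + g) z = a *: f z + g z by [].
  rewrite !E lf lg !scalerDr !scalerA (mulrC a b) -!addrA; congr (_ + _).
  by rewrite addrCA.
exists (complex.Re `|a| * M + N) => x.
have -> : (a *: f + g) x = a *: f x + g x by [].
rewrite (le_trans (ler_rnormD _ _))// rnormZ mulrDl lerD// -mulrA.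
by rewrite ler_wpM2l// Re_norm_ge0.
Qed.

HB.instance Definition _ :=
  GRing.isSubmodClosed.Build R[i] (V -> W) bounded_linear
    bounded_linear_submod_closed.
HB.instance Definition _ := [SubChoice_isSubLmodule of bop by <:].

Definition opnorm (f : bop) : R :=
  sup [set rnorm (f x) | x in [set x : V | rnorm x <= 1]].

Lemma bopZ (f : bop) (a : R[i]) x : f (a *: x) = a *: f x.
Proof.
have [lf _] := bopP f; have f0 : f 0 = 0.
  by have := lf (-1) 0 0; rewrite scaler0 addr0 scaleN1r addNr.
by have := lf a x 0; rewrite !addr0 f0 addr0.
Qed.

Lemma has_sup_opnorm (f : bop) :
  has_sup [set rnorm (f x) | x in [set x : V | rnorm x <= 1]].
Proof.
split; first by exists (rnorm (f 0)), 0 => //=; rewrite rnorm0 ler01.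
have [_ [M fM]] := bopP f.
exists `|M| => _ [x /= x1 <-]; rewrite (le_trans (fM x))//.
rewrite (le_trans (ler_wpM2r (rnorm_ge0 x) (ler_norm M)))//.
by rewrite ler_piMr.
Qed.

Lemma opnorm_ub (f : bop) x : rnorm x <= 1 -> rnorm (f x) <= opnorm f.
Proof. by move=> x1; apply: ub_le_sup; [case: (has_sup_opnorm f)|exists x]. Qed.

Lemma opnorm_le (f : bop) (M : R) :
  (forall x, rnorm x <= 1 -> rnorm (f x) <= M) -> opnorm f <= M.
Proof.
move=> fM; apply: ge_sup; first by case: (has_sup_opnorm f).
by move=> _ [x /= x1 <-]; exact: fM.
Qed.

Lemma opnorm_ge0 f : 0 <= opnorm f.
Proof.
by rewrite (le_trans (rnorm_ge0 (f 0)))// opnorm_ub// rnorm0 ler01.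
Qed.

Lemma le_opnorm (f : bop) x : rnorm (f x) <= opnorm f * rnorm x.
Proof.
have [x0|x0] := eqVneq (rnorm x) 0.
  have [_ [M fM]] := bopP f.
  by rewrite x0 mulr0 (le_trans (fM x))// x0 mulr0.
have xp : 0 < rnorm x by rewrite lt0r x0 rnorm_ge0.
have E : complex.Re `|(rnorm x)^-1%:C| = (rnorm x)^-1.
  by rewrite ger0_norm// ler0c invr_ge0 rnorm_ge0.
have := @opnorm_ub f ((rnorm x)^-1%:C *: x).
rewrite bopZ !rnormZ E mulVf// => /(_ (lexx _)).
by rewrite mulrC ler_pdivrMr.
Qed.

Let bop_norm (f : bop) : R[i] := (opnorm f)%:C.

Lemma bop_normD f g : bop_norm (f + g) <= bop_norm f + bop_norm g.
Proof.
rewrite /bop_norm -real_complexD lecR; apply: opnorm_le => x x1.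
by rewrite (le_trans (ler_rnormD _ _))// lerD// opnorm_ub.
Qed.

Lemma opnormZ_le (a : R[i]) f : opnorm (a *: f) <= complex.Re `|a| * opnorm f.
Proof.
apply: opnorm_le => x x1; rewrite [X in rnorm X](_ : _ = a *: f x)//.
by rewrite rnormZ ler_wpM2l ?Re_norm_ge0// opnorm_ub.
Qed.

Lemma bop_normZ (a : R[i]) f : bop_norm (a *: f) = `|a| * bop_norm f.
Proof.
rewrite /bop_norm [`|a|]normCE -real_complexM; congr (_%:C).
apply/eqP; rewrite eq_le opnormZ_le andTb.
have [->|a0] := eqVneq a 0; first by rewrite normr0 mul0r opnorm_ge0.
have := opnormZ_le a^-1 (a *: f); rewrite scalerA mulVf// scale1r normfV.
by rewrite Re_normV -ler_pdivlMl// Re_norm_gt0.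
Qed.

Lemma bop_norm0_eq0 f : bop_norm f = 0 -> f = 0.
Proof.
move=> [f0]; apply/val_inj/funext => x /=; apply/rnorm0_eq0/le_anti.
by rewrite rnorm_ge0 andbT (le_trans (le_opnorm f x))// f0 mul0r.
Qed.

HB.instance Definition _ :=
  Lmodule_isNormed.Build R[i] bop bop_normD bop_normZ bop_norm0_eq0.

End bounded_operators.

Lemma bop_id_subproof {R : realType} (V : normedModType R[i]) :
  (idfun : V -> V) \in @bounded_linear R V V.
Proof. by apply/bounded_linearP; split=> //; exists 1 => x; rewrite mul1r. Qed.

Definition bop_id {R : realType} {V : normedModType R[i]} : bop V V :=
  Bop (bop_id_subproof V).

Section square_summable_families.
Context {R : realType} (I : choiceType) (H : normedModType R[i]).
Implicit Types g h : I -> H.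

Definition sqsum g : \bar R := \esum_(i in [set: I]) ((rnorm (g i)) ^+ 2)%:E.

Definition square_summable : {pred I -> H} := fun g => (sqsum g < +oo)%E.

Record ell2 := Ell2 { ell2_fun :> I -> H; _ : ell2_fun \in square_summable }.

HB.instance Definition _ := [isSub for ell2_fun].
HB.instance Definition _ := [Choice of ell2 by <:].

Lemma sqsum_ge0 g : (0 <= sqsum g)%E.
Proof. by apply: esum_ge0 => i _; rewrite lee_fin sqr_ge0. Qed.

Lemma sqsum_finE g : g \in square_summable -> sqsum g = (fine (sqsum g))%:E.
Proof. by move=> gs; rewrite fineK// ge0_fin_numE// sqsum_ge0. Qed.

Lemma sqsum_leP g (M : R) : (sqsum g <= M%:E)%E <->
  (forall F, finite_set F -> \sum_(i \in F) rnorm (g i) ^+ 2 <= M).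
Proof.
split=> [gM F finF|gM].
  rewrite -lee_fin -fsumEFin// (le_trans _ gM)//.
  by apply: ereal_sup_ubound; exists F.
apply: ge_ereal_sup => _ [F [finF _] <-].
by rewrite fsumEFin// lee_fin gM.
Qed.

Lemma minkowski_pos g h (M N : R) : 0 < M -> 0 < N ->
  (sqsum g <= (M ^+ 2)%:E)%E -> (sqsum h <= (N ^+ 2)%:E)%E ->
  (sqsum (g + h)%R <= ((M + N) ^+ 2)%:E)%E.
Proof.
move=> M0 N0 /sqsum_leP gM /sqsum_leP hN; apply/sqsum_leP => F finF.
pose p := (M + N) / M; pose q := (M + N) / N.
have p0 : 0 <= p by rewrite divr_ge0// ?addr_ge0// ltW.
have q0 : 0 <= q by rewrite divr_ge0// ?addr_ge0// ltW.
apply: (@le_trans _ _ (p * M ^+ 2 + q * N ^+ 2)); last first.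
  rewrite le_eqVlt; apply/orP; left; apply/eqP; rewrite /p /q.
  by field; rewrite !gt_eqF.
apply: (@le_trans _ _ (p * \sum_(i \in F) rnorm (g i) ^+ 2 +
                       q * \sum_(i \in F) rnorm (h i) ^+ 2)); last first.
  by rewrite lerD// ler_wpM2l// ?gM// hN.
rewrite !(fsbig_finite _ _ finF)/= !mulr_sumr -big_split/=; apply: ler_sum => i _.
have -> : (g + h) i = g i + h i by [].
have := ler_rnormD (g i) (h i); have := rnorm_ge0 (g i + h i).
move: (rnorm _) (rnorm (g i)) (rnorm (h i)) => c a b c0 cab.
apply: (@le_trans _ _ ((a + b) ^+ 2)).
  by rewrite ler_pXn2r// nnegrE// (le_trans c0).
rewrite -subr_ge0 [X in 0 <= X](_ : _ = (a * N - b * M) ^+ 2 / (M * N)); last first.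
  by rewrite /p /q; field; rewrite !gt_eqF.
by rewrite divr_ge0// ?sqr_ge0// mulr_ge0// ltW.
Qed.

Lemma sqsumZ_le (a : R[i]) g (M : R) : (sqsum g <= M%:E)%E ->
  (sqsum (a *: g)%R <= ((complex.Re `|a|) ^+ 2 * M)%:E)%E.
Proof.
move=> /sqsum_leP gM; apply/sqsum_leP => F finF.
rewrite (le_trans _ (ler_wpM2l (sqr_ge0 _) (gM F finF)))//.
rewrite !(fsbig_finite _ _ finF) mulr_sumr; apply: ler_sum => i _.
by rewrite -exprMn -rnormZ.
Qed.

Lemma square_summableP g :
  reflect (exists M : R, (sqsum g <= M%:E)%E) (g \in square_summable).
Proof.
apply: (iffP idP) => [gs|[M gM]]; first by exists (fine (sqsum g)); rewrite -sqsum_finE.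
by rewrite unfold_in /square_summable (le_lt_trans gM)// ltry.
Qed.

Lemma square_summable_submod_closed : submod_closed square_summable.
Proof.
split.
  apply/square_summableP; exists 0; apply/sqsum_leP => F finF.
  rewrite (fsbig_finite _ _ finF) big1// => i _.
  by rewrite [X in rnorm X](_ : _ = 0)// rnorm0 expr0n.
move=> a g h /square_summableP[M gM] /square_summableP[N hN].
apply/square_summableP.
have sq (x : R) : x <= (`|x| + 1) ^+ 2.
  have := ler_norm x; have := normr_ge0 x; move: `|x| => y; nra.
have p (x : R) : 0 < `|x| + 1 by rewrite ltr_wpDl.
exists ((`|complex.Re `|a| ^+ 2 * M| + 1 + (`|N| + 1)) ^+ 2).
apply: minkowski_pos => //.
  by apply: (le_trans (sqsumZ_le a gM)); rewrite lee_fin.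
by apply: (le_trans hN); rewrite lee_fin.
Qed.

HB.instance Definition _ :=
  GRing.isSubmodClosed.Build R[i] (I -> H) square_summable
    square_summable_submod_closed.
HB.instance Definition _ := [SubChoice_isSubLmodule of ell2 by <:].

Definition ell2norm (g : ell2) : R := Num.sqrt (fine (sqsum g)).

Lemma ell2norm_ge0 (g : ell2) : 0 <= ell2norm g. Proof. exact: sqrtr_ge0. Qed.

Lemma ell2normE (g : ell2) : sqsum g = (ell2norm g ^+ 2)%:E.
Proof.
rewrite sqr_sqrtr ?fine_ge0 ?sqsum_ge0// -sqsum_finE//; exact: (valP g).
Qed.

Lemma ell2norm_le (g : ell2) (M : R) : 0 <= M ->
  (sqsum g <= (M ^+ 2)%:E)%E -> ell2norm g <= M.
Proof.
by move=> M0; rewrite ell2normE lee_fin ler_pXn2r// ?nnegrE// ell2norm_ge0.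
Qed.

Let ell2_norm (g : ell2) : R[i] := (ell2norm g)%:C.

Lemma ell2_normD (g h : ell2) : ell2_norm (g + h) <= ell2_norm g + ell2_norm h.
Proof.
rewrite /ell2_norm -real_complexD lecR; apply/ler_addgt0Pr => e e0.
have e20 : 0 < e / 2 by rewrite divr_gt0.
have [g0 h0] := (ell2norm_ge0 g, ell2norm_ge0 h).
rewrite (_ : _ + e = ell2norm g + e / 2 + (ell2norm h + e / 2)); last by field.
have sq (x : R) : 0 <= x -> x ^+ 2 <= (x + e / 2) ^+ 2 by move=> x0; nra.
apply: ell2norm_le; first by rewrite !addr_ge0// ltW.
apply: (@minkowski_pos g h); rewrite ?ltr_wpDl//.
- by rewrite ell2normE lee_fin sq.
- by rewrite ell2normE lee_fin sq.
Qed.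

Lemma ell2normZ_le (a : R[i]) (g : ell2) :
  ell2norm (a *: g) <= complex.Re `|a| * ell2norm g.
Proof.
apply: ell2norm_le; first by rewrite mulr_ge0 ?Re_norm_ge0 ?ell2norm_ge0.
by rewrite exprMn; apply: (@sqsumZ_le a g); rewrite ell2normE.
Qed.

Lemma ell2_normZ (a : R[i]) (g : ell2) : ell2_norm (a *: g) = `|a| * ell2_norm g.
Proof.
rewrite /ell2_norm [`|a|]normCE -real_complexM; congr (_%:C).
apply/eqP; rewrite eq_le ell2normZ_le andTb.
have [->|a0] := eqVneq a 0; first by rewrite normr0 mul0r ell2norm_ge0.
have := ell2normZ_le a^-1 (a *: g); rewrite scalerA mulVf// scale1r normfV.
by rewrite Re_normV -ler_pdivlMl// Re_norm_gt0.
Qed.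

Lemma ell2_norm0_eq0 (g : ell2) : ell2_norm g = 0 -> g = 0.
Proof.
move=> [g0]; apply/val_inj/funext => i /=; apply/rnorm0_eq0/eqP.
rewrite -sqrf_eq0 eq_le sqr_ge0 andbT.
have : (sqsum g <= 0%:E)%E by rewrite ell2normE g0 expr0n.
by move=> /sqsum_leP/(_ [set i] (finite_set1 i)); rewrite fsbig_set1.
Qed.

HB.instance Definition _ :=
  Lmodule_isNormed.Build R[i] ell2 ell2_normD ell2_normZ ell2_norm0_eq0.

End square_summable_families.

(* Unconditional summation: convergence of the finite partial sums along the
   directed set of finite subsets of I. *)
Definition has_sum {R : realType} {I : choiceType} {V : normedModType R[i]}
    (f : I -> V) (v : V) : Prop :=
  summability.partial_sum f @ summability.totally --> v.

Section euclidean_space.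
Context {R : realType} {d : nat}.

(* The library norm on 'rV[R]_d is the sup norm. *)
Definition euclid_norm (x : 'rV[R]_d) : R :=
  Num.sqrt (\sum_(i < d) x 0 i ^+ 2).

Definition nu (s : R) (x : 'rV[R]_d) : R := (1 + euclid_norm x) `^ s.

Definition unit_cube (x : 'rV[R]_d) : set 'rV[R]_d :=
  [set y | forall i, x 0 i <= y 0 i <= x 0 i + 1].

Definition relatively_separated (X : set 'rV[R]_d) : Prop :=
  exists N : nat, forall x, (X `&` unit_cube x #<= `I_N)%card.

End euclidean_space.

Section operator_matrices.
Context {R : realType} (I : choiceType) (H : normedModType R[i]).

Definition opmx : Type := I -> I -> bop H H.
HB.instance Definition _ := GRing.Lmodule.copy opmx (I -> I -> bop H H).

(* The entry \sum_n A_{k,n} B_{n,l} is a sum in the strong operator topology: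
   this is the mode of convergence valid for the matrices of arbitrary bounded
   operators on ell2, and it gives the same value as convergence in norm when
   the latter holds. *)
Definition opmx_mul (A B : opmx) : opmx := fun k l =>
  xget 0 [set T : bop H H | forall x, has_sum (fun n => A k n (B n l x)) (T x)].

Definition opmx_one : opmx := fun k l => if k == l then bop_id else 0.

(* T is the bounded operator on ell2 with which the matrix A is identified. *)
Definition represents (A : opmx) (T : bop (ell2 I H) (ell2 I H)) : Prop :=
  forall (g : ell2 I H) k, has_sum (fun l => A k l (g l)) (T g k).

Definition inverse_closed (J : set opmx) : Prop :=
  forall A, J A -> exists2 T, represents A T &
    forall S : bop (ell2 I H) (ell2 I H), cancel T S -> cancel S T ->
      exists2 B, J B & represents B S.

Context (dot : {dot H for Num.conj}).

Definition adjoint (T : bop H H) : bop H H :=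
  xget 0 [set S : bop H H | forall x y, dot (T x) y = dot x (S y)].

Definition opmx_star (A : opmx) : opmx := fun k l => adjoint (A l k).

End operator_matrices.

Arguments opmx_one {R} I H.

Section jaffard.
Context {R : realType} {d : nat} (X : set 'rV[R]_d) (H : normedModType R[i]).
Variable s : R.

Definition jaffard_weights (A : opmx X H) : set R :=
  [set rnorm (A kl.1 kl.2) * nu s (val kl.1 - val kl.2) | kl in [set: X * X]].

Definition jaffard : set (opmx X H) :=
  [set A | has_ubound (jaffard_weights A)].

Definition jaffard_norm (A : opmx X H) : R := sup (jaffard_weights A).

Definition jaffard_opnorm (A : opmx X H) : R :=
  sup [set jaffard_norm (opmx_mul A B) |
       B in [set B | jaffard B /\ jaffard_norm B = 1]].

End jaffard.

Arguments jaffard {R d} X H s.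

(* J, a set of elements of the ambient vector space M, is a unital Banach
   algebra with an involution; mul, star and nrm only matter on J. *)
Record involutive_banach_algebra {R : realType} {M : lmodType R[i]}
    (J : set M) (mul : M -> M -> M) (one : M) (star : M -> M) (nrm : M -> R)
    : Prop := {
  iba_zero : J 0 ;
  iba_lin : forall a A B, J A -> J B -> J (a *: A + B) ;
  iba_mul : forall A B, J A -> J B -> J (mul A B) ;
  iba_one : J one ;
  iba_star : forall A, J A -> J (star A) ;
  iba_mulA : forall A B C, J A -> J B -> J C ->
    mul A (mul B C) = mul (mul A B) C ;
  iba_mul1 : forall A, J A -> mul one A = A /\ mul A one = A ;
  iba_mulDl : forall a A B C, J A -> J B -> J C ->
    mul (a *: A + B) C = a *: mul A C + mul B C ;
  iba_mulDr : forall a A B C, J A -> J B -> J C ->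
    mul C (a *: A + B) = a *: mul C A + mul C B ;
  iba_starK : forall A, J A -> star (star A) = A ;
  iba_starD : forall a A B, J A -> J B ->
    star (a *: A + B) = a^* *: star A + star B ;
  iba_starM : forall A B, J A -> J B ->
    star (mul A B) = mul (star B) (star A) ;
  iba_norm0 : forall A, J A -> nrm A = 0 -> A = 0 ;
  iba_normD : forall A B, J A -> J B -> nrm (A + B) <= nrm A + nrm B ;
  iba_normZ : forall a A, J A -> nrm (a *: A) = complex.Re `|a| * nrm A ;
  iba_normM : forall A B, J A -> J B -> nrm (mul A B) <= nrm A * nrm B ;
  iba_complete : forall u : nat -> M, (forall n, J (u n)) ->
    (forall e : R, 0 < e -> exists N, forall m n, (N <= m)%N -> (N <= n)%N ->
      nrm (u m - u n) < e) ->
    exists2 A, J A & nrm (u n - A) @[n --> \oo] --> (0 : R)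
}.

Definition spectrum {R : realType} {M : lmodType R[i]} (J : set M)
    (mul : M -> M -> M) (one A : M) : set R[i] :=
  [set z | ~ exists2 B, J B &
    mul (A - z *: one) B = one /\ mul B (A - z *: one) = one].

(* On R[i], 0 <= z means that z is real and nonnegative. *)
Definition symmetric_banach_algebra {R : realType} {M : lmodType R[i]}
    (J : set M) (mul : M -> M -> M) (one : M) (star : M -> M) (nrm : M -> R)
    : Prop :=
  involutive_banach_algebra J mul one star nrm /\
  forall A, J A -> spectrum J mul one (mul (star A) A) `<=` [set z | 0 <= z].

(* Main.v *)
Require Import Defs.
From mathcomp Require Import all_boot all_order all_algebra complex finmap.
From mathcomp Require Import all_classical all_reals all_analysis.
From mathcomp Require Import ring lra.
From mathcomp.analysis.showcase Require summability.
Set Implicit Arguments.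
Unset Strict Implicit.
Unset Printing Implicit Defensive.
Import Order.TTheory GRing.Theory Num.Theory.
Import numFieldNormedType.Exports.
Local Open Scope classical_set_scope.
Local Open Scope ring_scope.
Local Open Scope complex_scope.

(** Matrices over X with entries in B(H) are handled through the operators that they
    represent on [ell2]: on the Jaffard class the maps [entry] and [op] are inverse to
    each other and turn the matrix product into composition ([opmx_mul_entry]). The
    algebraic laws are thus those of operators, and only the norm estimates concern
    entries.

    The key estimate is [jaffard_sqr_bound]. Because nu_s(k - l) is at most
    2^s (nu_s(k - n) + nu_s(n - l)), the decay of order s of a product A A requires
    decay of order s from one factor only; from the other factor it requires a decay of
    some order t > d, enough for summability over a relatively separated set
    ([sum_nuV_le]). Every entry of A is bounded by the operator norm of A. Interpolating
    between this bound and the decay of order s yields decay of order t = s th, with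
    th < 1, and therefore
      |A A|_J <= K |A|_J^(1 + th) |A|_op^(1 - th).
    Since 1 + th < 2, iteration shows that the powers A^(2^n) tend to 0 in the Jaffard
    norm as soon as |A|_op < 1 ([superlinear_decay]). A Neumann series then inverts
    1 - A^(2^n) in the Jaffard algebra, and the factorization
    1 - A^2 = (1 - A) (1 + A) brings the inverse back to 1 - A
    ([jaffard_one_sub_invertible]).

    If A is bounded below on [ell2], then 1 - tau A*A is a strict contraction for a
    small tau > 0, so A*A is invertible in the Jaffard algebra ([star_mul_invertible]).
    For an invertible A this produces the inverse (A*A)^-1 A* inside the algebra. For the
    symmetry the same argument is applied to the normal element A*A - z, which is
    bounded below unless z is a nonnegative real ([spectrum_star_mul]).

    The adjoints come from the Riesz representation theorem ([real_riesz]), and all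
    Hilbert space computations use the real part of the inner product. *)

(** * Unconditional sums *)

Import summability.
#[local] Existing Instance totally_filter.

Section unconditional_sums.
Context {R : realType} {I : choiceType}.
Implicit Types F G : {fset I}.

Lemma partial_sumE (V : zmodType) (f : I -> V) F :
  partial_sum f F = \sum_(i <- F) f i.
Proof. by rewrite /partial_sum big_seq_fsetE. Qed.

Lemma sum_fsetID (V : nmodType) (f : I -> V) F G : (F `<=` G)%fset ->
  \sum_(i <- G) f i = \sum_(i <- F) f i + \sum_(i <- (G `\` F)%fset) f i.
Proof.
move=> FG; rewrite (big_fsetID _ (mem F))/=; congr (_ + _); apply: eq_fbigl => i.
  rewrite !inE/=; apply/andP/idP => [[]//|iF]; split=> //; exact: (fsubsetP FG).
by rewrite !inE/= andbC.
Qed.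

Lemma ler_sum_fset (f : I -> R) F G : (forall i, 0 <= f i) -> (F `<=` G)%fset ->
  \sum_(i <- F) f i <= \sum_(i <- G) f i.
Proof. by move=> f0 FG; rewrite (sum_fsetID _ FG) lerDl sumr_ge0. Qed.

Lemma has_sumP (V : normedModType R[i]) (f : I -> V) v : has_sum f v <->
  forall e : R, 0 < e -> exists F, forall G, (F `<=` G)%fset ->
    rnorm (v - \sum_(i <- G) f i) < e.
Proof.
split=> [/cvgrPdist_lt fv e e0|fv].
  have [|F _ FP] := fv e%:C; first by rewrite ltcR.
  by exists F => G FG; have := FP G FG; rewrite rnormE ltcR partial_sumE.
apply/cvgrPdist_lt => /= e e0.
have [e' e'0 ee'] : exists2 e', 0 < e' & e = e'%:C :> R[i].
  by exists (complex.Re e); rewrite -?ltcR RRe_real// ger0_real// ltW.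
have [F FP] := fv _ e'0; exists F => // G FG; rewrite /mkset.
by rewrite partial_sumE rnormE ee' ltcR FP.
Qed.

(** The counterpart of [has_sum] for real values, R not being a normed space over R[i]. *)
Definition real_sum (f : I -> R) (v : R) : Prop :=
  forall e : R, 0 < e -> exists F, forall G, (F `<=` G)%fset ->
    `|v - \sum_(i <- G) f i| < e.

Lemma real_sum_unique f v w : real_sum f v -> real_sum f w -> v = w.
Proof.
move=> fv fw; apply/eqP; rewrite -subr_eq0 -normr_le0.
apply/ler_addgt0Pr => e e0; rewrite add0r.
have e20 : 0 < e / 2 by rewrite divr_gt0.
have [F FP] := fv _ e20; have [G GP] := fw _ e20.
have := FP _ (fsubsetUl F G); have := GP _ (fsubsetUr F G).
set t := \sum_(i <- _) _.
have := ler_normB (v - t) (w - t); rewrite opprB addrA subrK => A B C.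
rewrite (le_trans A)//; lra.
Qed.

Lemma real_sumD f g v w : real_sum f v -> real_sum g w ->
  real_sum (fun i => f i + g i) (v + w).
Proof.
move=> fv gw e e0.
have e20 : 0 < e / 2 by rewrite divr_gt0.
have [F FP] := fv _ e20; have [G GP] := gw _ e20.
exists (F `|` G)%fset => S; rewrite fsubUset => /andP[FS GS].
rewrite big_split/= opprD addrACA (le_lt_trans (ler_normD _ _))//.
by rewrite (splitr e) ltrD ?FP ?GP.
Qed.

Lemma real_sumZ c f v : real_sum f v -> real_sum (fun i => c * f i) (c * v).
Proof.
move=> fv e e0; have c0 : 0 < `|c| + 1 by rewrite ltr_wpDl.
have [|F FP] := fv (e / (`|c| + 1)); first by rewrite divr_gt0.
exists F => G FG; rewrite -mulr_sumr -mulrBr normrM.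
apply: (@le_lt_trans _ _ ((`|c| + 1) * `|v - \sum_(i <- G) f i|)).
  by rewrite ler_wpM2r// lerDl.
by rewrite mulrC -ltr_pdivlMr// FP.
Qed.

Lemma nneg_real_sum (f : I -> R) v : (forall i, 0 <= f i) ->
  (forall F, \sum_(i <- F) f i <= v) ->
  (forall e, 0 < e -> exists F, v - e < \sum_(i <- F) f i) -> real_sum f v.
Proof.
move=> f0 fv ve e e0; have [F FP] := ve e e0; exists F => G FG.
rewrite ger0_norm ?subr_ge0 ?fv// ltrBlDr -ltrBlDl.
exact: (lt_le_trans FP (ler_sum_fset f0 FG)).
Qed.

Context {V : normedModType R[i]}.
Implicit Types (f : I -> V) (v : V).

Lemma rnormN (x : V) : rnorm (- x) = rnorm x.
Proof. by rewrite /rnorm normrN. Qed.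

Lemma rnormB (x y : V) : rnorm (x - y) = rnorm (y - x).
Proof. by rewrite /rnorm distrC. Qed.

Lemma ler_rnorm_sum (J : Type) (r : seq J) (P : pred J) (F : J -> V) :
  rnorm (\sum_(i <- r | P i) F i) <= \sum_(i <- r | P i) rnorm (F i).
Proof.
elim/big_ind2 : _ => [|x a y b xa yb|//]; first by rewrite rnorm0.
by rewrite (le_trans (ler_rnormD _ _))// lerD.
Qed.

Lemma rnorm_le_near (x y : V) e : rnorm (x - y) <= e -> rnorm x <= rnorm y + e.
Proof.
move=> xy; rewrite -[x in leLHS](subrK y) addrC.
by rewrite (le_trans (ler_rnormD _ _))// lerD2l.
Qed.

Lemma has_sum_unique f v w : has_sum f v -> has_sum f w -> v = w.
Proof.
move=> fv fw; apply: (cvg_unique _ fv fw).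
exact: norm_hausdorff.
Qed.

Lemma has_sum_rnorm_le f v M : has_sum f v ->
  (forall F, rnorm (\sum_(i <- F) f i) <= M) -> rnorm v <= M.
Proof.
move=> /has_sumP fv fM; apply/ler_addgt0Pr => e e0.
have [F FP] := fv _ e0; rewrite (le_trans (rnorm_le_near (ltW (FP F _))))//.
by rewrite lerD2r.
Qed.

Lemma sum_map_approx (W : zmodType) (N : W -> R) (phi : V -> W) M f v :
  (forall x y, phi (x + y) = phi x + phi y) ->
  (forall x, N (phi x) <= M * rnorm x) -> has_sum f v ->
  forall e : R, 0 < e -> exists F, forall G, (F `<=` G)%fset ->
    N (phi v - \sum_(i <- G) phi (f i)) < e.
Proof.
move=> phiD phiM /has_sumP fv e e0.
have phi0 : phi 0 = 0.
  by apply/eqP; rewrite -(inj_eq (addrI (phi 0))) -phiD !addr0.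
have phiN x : phi (- x) = - phi x by apply/eqP; rewrite -addr_eq0 -phiD addNr phi0.
have c0 : 0 < `|M| + 1 by rewrite ltr_wpDl.
have [|F FP] := fv (e / (`|M| + 1)); first by rewrite divr_gt0.
exists F => G FG; rewrite -(big_morph phi phiD phi0) -phiN -phiD.
apply: (le_lt_trans (phiM _)).
apply: (@le_lt_trans _ _ ((`|M| + 1) * rnorm (v - \sum_(i <- G) f i))).
  by rewrite ler_wpM2r ?rnorm_ge0// (le_trans (ler_norm _))// lerDl.
by rewrite mulrC -ltr_pdivlMr// FP.
Qed.

Lemma has_sum_map (W : normedModType R[i]) (phi : V -> W) M f v :
  (forall x y, phi (x + y) = phi x + phi y) ->
  (forall x, rnorm (phi x) <= M * rnorm x) ->
  has_sum f v -> has_sum (fun i => phi (f i)) (phi v).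
Proof. by move=> phiD phiM fv; apply/has_sumP; exact: (sum_map_approx phiD phiM fv). Qed.

Lemma real_sum_map (phi : V -> R) M f v :
  (forall x y, phi (x + y) = phi x + phi y) ->
  (forall x, `|phi x| <= M * rnorm x) ->
  has_sum f v -> real_sum (fun i => phi (f i)) (phi v).
Proof. by move=> phiD phiM fv; exact: (sum_map_approx phiD phiM fv). Qed.

Lemma has_sumD f g v w : has_sum f v -> has_sum g w ->
  has_sum (fun i => f i + g i) (v + w).
Proof.
move=> /has_sumP fv /has_sumP gw; apply/has_sumP => e e0.
have e20 : 0 < e / 2 by rewrite divr_gt0.
have [F FP] := fv _ e20; have [G GP] := gw _ e20.
exists (F `|` G)%fset => S; rewrite fsubUset => /andP[FS GS].
rewrite big_split/= opprD addrACA (le_lt_trans (ler_rnormD _ _))//.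
by rewrite (splitr e) ltrD ?FP ?GP.
Qed.

Lemma has_sumZ (a : R[i]) f v : has_sum f v ->
  has_sum (fun i => a *: f i) (a *: v).
Proof.
move=> fv; apply: (@has_sum_map _ (fun x => a *: x) (complex.Re `|a|)) => //.
  by move=> x y; rewrite scalerDr.
by move=> x; rewrite rnormZ.
Qed.

Lemma has_sum_eq f g v : f =1 g -> has_sum f v -> has_sum g v.
Proof. by move=> /funext ->. Qed.

Lemma has_sum_single f i : (forall j, j != i -> f j = 0) -> has_sum f (f i).
Proof.
move=> f0; apply/has_sumP => e e0; exists [fset i]%fset => G iG.
rewrite (sum_fsetID _ iG) big_seq_fset1 big_seq_cond big1 ?addr0 ?subrr ?rnorm0//.
by move=> j /andP[+ _]; rewrite !inE => /andP[ji _]; rewrite f0.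
Qed.

End unconditional_sums.

Lemma invn_lt {R : realType} (e : R) : 0 < e ->
  exists N, forall n, (N <= n)%N -> n.+1%:R^-1 < e.
Proof.
move=> e0; exists (Num.bound e^-1) => n Nn.
rewrite invf_plt ?posrE ?ltr0n// (lt_le_trans (archi_boundP _)) ?invr_ge0 ?ltW//.
by rewrite ltr_nat ltnS.
Qed.

Section completeness.
Context {R : realType} {V : completeNormedModType R[i]}.

Lemma rnorm_cauchy_cvg (u : nat -> V) :
  (forall e : R, 0 < e -> exists N, forall m n, (N <= m)%N -> (N <= n)%N ->
    rnorm (u m - u n) < e) ->
  exists v, forall e : R, 0 < e -> exists N, forall n, (N <= n)%N ->
    rnorm (u n - v) < e.
Proof.
move=> uC.
have /cauchy_cvgP/cvg_ex[v /cvgrPdist_lt uv] : cauchy (u @ \oo).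
  apply/cauchyP => e e0.
  have [e' e'0 ee'] : exists2 e', 0 < e' & e = e'%:C :> R[i].
    by exists (complex.Re e); rewrite -?ltcR RRe_real// ger0_real// ltW.
  have [N NP] := uC _ e'0; exists (u N); exists N => // n /= Nn.
  by rewrite -ball_normE /= rnormE ee' ltcR NP.
exists v => e e0; have [|N _ NP] := uv e%:C; first by rewrite ltcR.
by exists N => n Nn; have := NP n Nn; rewrite /= rnormB rnormE ltcR.
Qed.

(** If the sum of the norms over F is within e of the supremum, then every finite
    set disjoint from F contributes at most e; hence the partial sums are Cauchy. *)
Lemma summable_has_sum (I : choiceType) (f : I -> V) (M : R) :
  (forall F : {fset I}, \sum_(i <- F) rnorm (f i) <= M) -> exists v, has_sum f v.
Proof.
move=> fM; pose S := [set \sum_(i <- F) rnorm (f i) | F in [set: {fset I}]].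
have supS : has_sup S.
  by split; [exists (\sum_(i <- fset0) rnorm (f i)), fset0|exists M => _ [F _ <-]].
have near e : 0 < e -> exists F : {fset I}, forall G, (F `<=` G)%fset ->
    rnorm (\sum_(i <- G) f i - \sum_(i <- F) f i) < e.
  move=> e0; have [_ [F _ <-] FP] := sup_adherent e0 supS; exists F => G FG.
  rewrite (sum_fsetID _ FG) addrC addrA addNr add0r.
  apply: (le_lt_trans (ler_rnorm_sum _ _ _)).
  have : \sum_(i <- G) rnorm (f i) <= sup S.
    by apply: sup_upper_bound => //; exists G.
  rewrite (sum_fsetID _ FG); lra.
have en n : 0 < (n.+1%:R^-1 : R) by rewrite invr_gt0 ltr0n.
pose F n := projT1 (cid (near _ (en n))).
have FP n G : (F n `<=` G)%fset ->
    rnorm (\sum_(i <- G) f i - \sum_(i <- F n) f i) < n.+1%:R^-1.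
  exact: (projT2 (cid (near _ (en n)))).
have [|v vP] := @rnorm_cauchy_cvg (fun n => \sum_(i <- F n) f i).
  move=> e e0; have [|N NP] := @invn_lt R (e / 2); first by rewrite divr_gt0.
  exists N => m n Nm Nn.
  have A := FP m _ (fsubsetUl (F m) (F n)); have B := FP n _ (fsubsetUr (F m) (F n)).
  have C := NP _ Nm; have D := NP _ Nn.
  move: A B; set t := \sum_(i <- (_ `|` _)%fset) _ => A B.
  have -> : \sum_(i <- F m) f i - \sum_(i <- F n) f i =
      (t - \sum_(i <- F n) f i) - (t - \sum_(i <- F m) f i).
    by rewrite opprB [RHS]addrC addrA subrK.
  apply: (le_lt_trans (ler_rnormD _ _)); rewrite rnormN.
  by rewrite (splitr e) ltrD// (lt_trans B D, lt_trans A C).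
exists v; apply/has_sumP => e e0.
have e20 : 0 < e / 2 by rewrite divr_gt0.
have [N NP] := invn_lt e20; have [N' N'P] := vP _ e20.
pose n := maxn N N'; exists (F n) => G FG.
have A := FP n _ FG; have B := NP n (leq_maxl _ _).
have C := N'P n (leq_maxr _ _).
rewrite -(subrK (\sum_(i <- F n) f i) v) -addrA.
apply: (le_lt_trans (ler_rnormD _ _)); rewrite rnormB [X in _ + X]rnormB.
by rewrite (splitr e) ltrD// (lt_trans A B).
Qed.

End completeness.

Section real_sums.
Context {R : realType} {I : choiceType}.
Implicit Types (f : I -> R) (F : {fset I}).

Lemma bounded_real_sum f M : (forall i, 0 <= f i) ->
  (forall F, \sum_(i <- F) f i <= M) ->
  exists v, real_sum f v /\ forall F, \sum_(i <- F) f i <= v.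
Proof.
move=> f0 fM; pose S := [set \sum_(i <- F) f i | F in [set: {fset I}]].
have supS : has_sup S.
  by split; [exists (\sum_(i <- fset0) f i), fset0|exists M => _ [F _ <-]].
have ub F : \sum_(i <- F) f i <= sup S by apply: sup_upper_bound => //; exists F.
exists (sup S); split=> //; apply: nneg_real_sum => // e e0.
by have [_ [F _ <-] FP] := sup_adherent e0 supS; exists F.
Qed.

Lemma real_sum_le f v M : real_sum f v -> (forall F, \sum_(i <- F) f i <= M) -> v <= M.
Proof.
move=> fv fM; apply/ler_addgt0Pr => e e0; have [F FP] := fv e e0.
have := FP F (fsubset_refl F); rewrite ltr_norml => /andP[_].
have := fM F; lra.
Qed.

Lemma real_sum_big (J : Type) (r : seq J) (f : J -> I -> R) (v : J -> R) :
  (forall j, real_sum (f j) (v j)) ->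
  real_sum (fun i => \sum_(j <- r) f j i) (\sum_(j <- r) v j).
Proof.
move=> fv; elim: r => [|j r IH].
  rewrite big_nil => e e0; exists fset0 => G _.
  by rewrite big1 ?subrr ?normr0// => i _; rewrite big_nil.
rewrite big_cons (_ : (fun i => _) = fun i => f j i + \sum_(j <- r) f j i).
  exact: real_sumD.
by apply/funext => i; rewrite big_cons.
Qed.

(** Expand sum_i w_i (W t_i - m)^2 >= 0, where m = sum_i w_i t_i. *)
Lemma weighted_cauchy_schwarz (r : seq I) (w t : I -> R) W : 0 < W ->
  (forall i, 0 <= w i) -> \sum_(i <- r) w i <= W ->
  (\sum_(i <- r) w i * t i) ^+ 2 <= W * \sum_(i <- r) w i * t i ^+ 2.
Proof.
move=> W0 w0 wW; set m := \sum_(i <- r) w i * t i; set Q := \sum_(i <- r) _.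
have : 0 <= \sum_(i <- r) w i * (W * t i - m) ^+ 2.
  by apply: sumr_ge0 => i _; rewrite mulr_ge0// sqr_ge0.
have -> : \sum_(i <- r) w i * (W * t i - m) ^+ 2 =
    W ^+ 2 * Q - 2 * W * m * m + m ^+ 2 * \sum_(i <- r) w i.
  transitivity (\sum_(i <- r)
    (W ^+ 2 * (w i * t i ^+ 2) + - (2 * W * m) * (w i * t i) + m ^+ 2 * w i)).
    by apply: eq_bigr => i _; ring.
  by rewrite !big_split/= -!mulr_sumr -/m -/Q; ring.
move=> D; have : 0 <= W * (W * Q - m ^+ 2).
  apply: (le_trans D); rewrite (_ : W * (W * Q - m ^+ 2) =
    W ^+ 2 * Q - 2 * W * m * m + m ^+ 2 * W); last by ring.
  by rewrite lerD2l ler_wpM2l// sqr_ge0.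
by rewrite pmulr_rge0// subr_ge0.
Qed.

Lemma product_split (u v x y a b p q c w z : R) :
  0 <= u -> 0 <= v -> 0 <= c -> 0 <= x -> 0 <= y ->
  u * x <= a -> v * y <= b -> u <= p * z -> v <= q * w ->
  u * v * (c * (x + y)) <= c * (a * q * w + p * b * z).
Proof.
move=> u0 v0 c0 x0 y0 ua vb up vq.
have -> : u * v * (c * (x + y)) = c * (u * x * v + u * (v * y)) by ring.
rewrite ler_wpM2l// lerD//; first by rewrite -(mulrA a) ler_pM// mulr_ge0.
by rewrite mulrAC ler_pM// mulr_ge0.
Qed.

Lemma sum_combination_le (r : seq I) (w z : I -> R) c a b W :
  0 <= c -> 0 <= a -> 0 <= b -> \sum_(i <- r) w i <= W -> \sum_(i <- r) z i <= W ->
  \sum_(i <- r) c * (a * w i + b * z i) <= c * W * (a + b).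
Proof.
move=> c0 a0 b0 wW zW; rewrite -mulr_sumr big_split/= -!mulr_sumr -mulrA.
by rewrite ler_wpM2l// mulrDr [leRHS]addrC addrC lerD// [leRHS]mulrC ler_wpM2l.
Qed.

End real_sums.

(** * Real parts of inner products, Riesz representation, adjoints *)

Section real_bilinear_forms.
Context {R : realType} {V : lmodType R[i]} (b : V -> V -> R) (N : V -> R).
Hypothesis bC : forall x y, b x y = b y x.
Hypothesis bD : forall x y z, b (x + y) z = b x z + b y z.
Hypothesis bZ : forall (t : R) x y, b (t%:C *: x) y = t * b x y.
Hypothesis bN : forall x, b x x = N x ^+ 2.

Lemma form_sqrD x y (t : R) :
  N (x + t%:C *: y) ^+ 2 = N x ^+ 2 + 2 * t * b x y + t ^+ 2 * N y ^+ 2.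
Proof.
have bDr z u v : b z (u + v) = b z u + b z v by rewrite bC bD !(bC z).
have bZr r u v : b u (r%:C *: v) = r * b u v by rewrite bC bZ (bC u).
by rewrite -!bN bD !bDr !bZr !bZ (bC y x); ring.
Qed.

Hypothesis N_ge0 : forall x, 0 <= N x.
Hypothesis N_eq0 : forall x, N x = 0 -> x = 0.

Lemma form_cauchy_schwarz x y : `|b x y| <= N x * N y.
Proof.
have [y0|y0] := eqVneq (N y) 0.
  have -> : y = 0%:C *: y by rewrite scale0r (N_eq0 y0).
  by rewrite bC bZ mul0r normr0 mulr_ge0.
have yp : 0 < N y by rewrite lt0r y0 N_ge0.
rewrite -(ler_pXn2r (ltn0Sn 1)) ?nnegrE ?mulr_ge0// real_normK ?num_real//.
have := sqr_ge0 (N (x + (- b x y / N y ^+ 2)%:C *: y)).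
rewrite form_sqrD [X in 0 <= X](_ : _ = ((N x * N y) ^+ 2 - b x y ^+ 2) / N y ^+ 2).
  by rewrite pmulr_lge0 ?subr_ge0// invr_gt0 exprn_gt0.
by field; rewrite gt_eqF.
Qed.

(** The quadratic polynomial t |-> N(x + t y)^2 - 2 phi(x + t y) stays above m and
    starts within e^2 of m, which bounds its discriminant. *)
Lemma near_minimizer_gradient (phi : V -> R) m e x :
  (forall x y, phi (x + y) = phi x + phi y) ->
  (forall (t : R) x, phi (t%:C *: x) = t * phi x) ->
  (forall z, m <= N z ^+ 2 - 2 * phi z) -> 0 <= e ->
  N x ^+ 2 - 2 * phi x <= m + e ^+ 2 ->
  forall y, `|b x y - phi y| <= e * N y.
Proof.
move=> phiD phiZ mP e0 xm y; set g := b x y - phi y.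
have H t : 0 <= e ^+ 2 + 2 * t * g + t ^+ 2 * N y ^+ 2.
  have := mP (x + t%:C *: y); rewrite form_sqrD phiD phiZ; rewrite /g; lra.
have [y0|y0] := eqVneq (N y) 0.
  have yE : y = 0%:C *: y by rewrite scale0r (N_eq0 y0).
  by rewrite /g y0 yE bC bZ phiZ !mul0r subrr normr0 mulr0.
have yp : 0 < N y by rewrite lt0r y0 N_ge0.
rewrite -(ler_pXn2r (ltn0Sn 1)) ?nnegrE ?mulr_ge0// real_normK ?num_real//.
have := H (- g / N y ^+ 2).
rewrite [X in 0 <= X](_ : _ = ((e * N y) ^+ 2 - g ^+ 2) / N y ^+ 2).
  by rewrite pmulr_lge0 ?subr_ge0// invr_gt0 exprn_gt0.
by field; rewrite gt_eqF.
Qed.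

End real_bilinear_forms.

Section real_part.
Context {R : realType}.
Implicit Types a b : R[i].

Lemma ReD a b : complex.Re (a + b) = complex.Re a + complex.Re b.
Proof. by case: a b => ? ? []. Qed.

Lemma ReZ (t : R) a : complex.Re (t%:C * a) = t * complex.Re a.
Proof. by case: a => ? ? /=; rewrite mul0r subr0. Qed.

Lemma ReiM a : complex.Re ('i%C * a) = - complex.Im a.
Proof. by case: a => ? ? /=; rewrite mul0r mul1r sub0r. Qed.

Lemma Re_conj a : complex.Re (a^*)%R = complex.Re a.
Proof. by case: a. Qed.

Lemma Im_conj a : complex.Im (a^*)%R = - complex.Im a.
Proof. by case: a. Qed.

Lemma eq_ReIm a b : complex.Re a = complex.Re b ->
  complex.Im a = complex.Im b -> a = b.
Proof. by case: a b => ? ? [? ?] /= -> ->. Qed.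

End real_part.

Section hilbert_space.
Context {R : realType} {H : normedModType R[i]} (dot : {dot H for Num.conj}).
Hypothesis dot_norm : forall x : H, `|x| ^+ 2 = dot x x.
Implicit Types x y z : H.

(** The real part determines the inner product, by [dot_rdotE], and is a symmetric
    real bilinear form, which spares all conjugations. *)
Definition rdot x y : R := complex.Re (dot x y).

Lemma dotC x y : dot x y = ((dot y x)^*)%R.
Proof. by rewrite [LHS]hermC expr0 mul1r. Qed.

Lemma rdotC x y : rdot x y = rdot y x.
Proof. by rewrite /rdot dotC Re_conj. Qed.

Lemma rdotDl x y z : rdot (x + y) z = rdot x z + rdot y z.
Proof. by rewrite /rdot linearDl; exact: ReD. Qed.

Lemma rdotDr x y z : rdot z (x + y) = rdot z x + rdot z y.
Proof. by rewrite !(rdotC z) rdotDl. Qed.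

Lemma rdotZl (t : R) x y : rdot (t%:C *: x) y = t * rdot x y.
Proof. by rewrite /rdot linearZl_LR; exact: ReZ. Qed.

Lemma rdotZr (t : R) x y : rdot x (t%:C *: y) = t * rdot x y.
Proof. by rewrite rdotC rdotZl rdotC. Qed.

Lemma rdot_im x y : rdot ('i%C *: x) y = - complex.Im (dot x y).
Proof. by rewrite /rdot linearZl_LR; exact: ReiM. Qed.

Lemma rdot_skew x y : rdot ('i%C *: x) y = - rdot x ('i%C *: y).
Proof.
by rewrite rdot_im (rdotC x) rdot_im dotC Im_conj !opprK.
Qed.

Lemma rdotxx x : rdot x x = rnorm x ^+ 2.
Proof. by rewrite /rdot -dot_norm rnormE -rmorphXn. Qed.

Lemma rdot_le x y : `|rdot x y| <= rnorm x * rnorm y.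
Proof.
apply: form_cauchy_schwarz; [exact: rdotC|exact: rdotDl|exact: rdotZl|exact: rdotxx|..].
  exact: rnorm_ge0.
exact: rnorm0_eq0.
Qed.

Lemma dot_rdotE x y x' y' : (rdot x y = rdot x' y') ->
  rdot ('i%C *: x) y = rdot ('i%C *: x') y' -> dot x y = dot x' y'.
Proof.
by rewrite !rdot_im => re /oppr_inj; exact: eq_ReIm.
Qed.

Lemma rdotNr x y : rdot x (- y) = - rdot x y.
Proof.
have -> : - y = (-1)%:C *: y by rewrite rmorphN rmorph1 scaleN1r.
by rewrite rdotC rdotZl mulN1r rdotC.
Qed.

Lemma rdot_inj y z : (forall x, rdot x y = rdot x z) -> y = z.
Proof.
move=> yz; apply/eqP; rewrite -subr_eq0; apply/eqP/rnorm0_eq0/eqP.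
by rewrite -sqrf_eq0 -rdotxx rdotDr rdotNr yz subrr.
Qed.

Definition adjoint_pair (T S : bop H H) := forall x y, rdot (T x) y = rdot x (S y).

End hilbert_space.

Section riesz.
Context {R : realType} {H : completeNormedModType R[i]} (dot : {dot H for Num.conj}).
Hypothesis dot_norm : forall x : H, `|x| ^+ 2 = dot x x.
Local Notation rdot := (rdot dot).

(** Near-minimizers of |z|^2 - 2 phi(z) represent phi up to a small multiple of the
    norm, by [near_minimizer_gradient]; tested against the difference of two of them,
    this makes a minimizing sequence Cauchy, and its limit represents phi. *)
Lemma real_riesz (phi : H -> R) (M : R) :
  (forall x y, phi (x + y) = phi x + phi y) ->
  (forall (t : R) x, phi (t%:C *: x) = t * phi x) ->
  (forall x, `|phi x| <= M * rnorm x) ->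
  exists z, forall x, phi x = rdot x z.
Proof.
move=> phiD phiZ phiM.
pose q z := rnorm z ^+ 2 - 2 * phi z.
have qM z : - M ^+ 2 <= q z.
  have := sqr_ge0 (rnorm z - M); have := phiM z; have := ler_norm (phi z).
  by rewrite /q; nra.
have infq : has_inf (range q).
  by split; [exists (q 0), 0|exists (- M ^+ 2) => _ [z _ <-]].
have mq z : inf (range q) <= rnorm z ^+ 2 - 2 * phi z.
  by apply: ge_inf; [exact: infq.2|exists z].
have en n : 0 < (n.+1%:R^-1 : R) ^+ 2 by rewrite exprn_gt0// invr_gt0 ltr0n.
have ex n : exists z, q z < inf (range q) + n.+1%:R^-1 ^+ 2.
  by have [_ [z _ <-] zP] := inf_adherent (en n) infq; exists z.
pose u n := projT1 (cid (ex n)).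
have uP n y : `|rdot (u n) y - phi y| <= n.+1%:R^-1 * rnorm y.
  have i0 : 0 <= n.+1%:R^-1 :> R by rewrite invr_ge0 ler0n.
  exact: (near_minimizer_gradient (rdotC dot) (rdotDl dot) (rdotZl dot)
    (rdotxx dot_norm) (@rnorm_ge0 _ _) (@rnorm0_eq0 _ _) phiD phiZ mq i0
    (ltW (projT2 (cid (ex n))))).
have rdotB x y z : rdot (x - y) z = rdot x z - rdot y z.
  by rewrite rdotDl; congr (_ + _); rewrite rdotC rdotNr rdotC.
have [|z zP] := @rnorm_cauchy_cvg _ _ u.
  move=> e e0; have [|N NP] := @invn_lt R (e / 2); first by rewrite divr_gt0.
  exists N => m n Nm Nn; set d := u m - u n.
  have [->|d0] := eqVneq (rnorm d) 0; first by [].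
  have dp : 0 < rnorm d by rewrite lt0r d0 rnorm_ge0.
  rewrite -(ltr_pM2l dp) -expr2 -(rdotxx dot_norm) [in rdot _ _]/d rdotB.
  have -> : rdot (u m) d - rdot (u n) d =
    (rdot (u m) d - phi d) - (rdot (u n) d - phi d) by ring.
  apply: (le_lt_trans (ler_norm _)); apply: (le_lt_trans (ler_normB _ _)).
  apply: (le_lt_trans (lerD (uP _ _) (uP _ _))).
  by rewrite -mulrDl mulrC ltr_pM2l// (splitr e) ltrD ?NP.
exists z => x; apply/eqP; rewrite eq_sym -subr_eq0 -normr_le0.
apply/ler_addgt0Pr => e e0; rewrite add0r.
have e' : 0 < e / (2 * (rnorm x + 1)).
  by rewrite divr_gt0// mulr_gt0// ltr_wpDl// rnorm_ge0.
have [N NP] := invn_lt e'; have [N' N'P] := zP _ e'.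
pose n := maxn N N'.
have A := NP n (leq_maxl _ _); have B := N'P n (leq_maxr _ _).
have -> : rdot x z - phi x = (rdot (u n) x - phi x) - rdot (u n - z) x.
  by rewrite rdotB (rdotC _ x); ring.
apply: (le_trans (ler_normB _ _)).
apply: (le_trans (lerD (uP _ _) (rdot_le dot_norm _ _))).
rewrite -mulrDl.
have C : n.+1%:R^-1 + rnorm (u n - z) <= e / (rnorm x + 1).
  apply/ltW; apply: (lt_le_trans (ltrD A B)).
  rewrite le_eqVlt; apply/orP; left; apply/eqP; field.
  by rewrite gt_eqF// ltr_wpDl// rnorm_ge0.
apply: (le_trans (ler_wpM2r (rnorm_ge0 _) C)).
rewrite mulrAC ler_pdivrMr ?ltr_wpDl ?rnorm_ge0//.
by rewrite ler_wpM2l ?lerDl// ltW.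
Qed.

Lemma bopD (V W : normedModType R[i]) (T : bop V W) x y : T (x + y) = T x + T y.
Proof. by have [lT _] := bopP T; have := lT 1 x y; rewrite !scale1r. Qed.

(** The real adjoint given by the Riesz representation commutes with i because i is
    skew for the real inner product, so it is complex linear. *)
Lemma adjoint_exists (T : bop H H) : exists S : bop H H,
  adjoint_pair dot T S /\ opnorm S <= opnorm T.
Proof.
have ex y : exists z, forall x, rdot (T x) y = rdot x z.
  apply: (@real_riesz (fun x => rdot (T x) y) (opnorm T * rnorm y)).
  - by move=> x x'; rewrite bopD rdotDl.
  - by move=> t x; rewrite bopZ rdotZl.
  - move=> x; apply: (le_trans (rdot_le dot_norm _ _)).
    by rewrite mulrAC ler_wpM2r ?rnorm_ge0// le_opnorm.
pose S y := projT1 (cid (ex y)).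
have SP x y : rdot (T x) y = rdot x (S y) by exact: (projT2 (cid (ex y))).
have SD y y' : S (y + y') = S y + S y'.
  by apply: (rdot_inj dot_norm) => x; rewrite rdotDr -!SP rdotDr.
have Si y : S ('i%C *: y) = 'i%C *: S y.
  apply: (rdot_inj dot_norm) => x.
  by rewrite -SP -[LHS]opprK -rdot_skew -bopZ SP rdot_skew opprK.
have Sr (t : R) y : S (t%:C *: y) = t%:C *: S y.
  by apply: (rdot_inj dot_norm) => x; rewrite -SP !rdotZr SP.
have SZ (a : R[i]) y : S (a *: y) = a *: S y.
  case: a => a c.
  have -> : a +i* c = a%:C + c%:C * 'i%C by simpc.
  by rewrite !scalerDl -!scalerA SD !Sr Si.
have SM y : rnorm (S y) <= opnorm T * rnorm y.
  have [->|y0] := eqVneq (rnorm (S y)) 0.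
    by rewrite mulr_ge0 ?opnorm_ge0 ?rnorm_ge0.
  have yp : 0 < rnorm (S y) by rewrite lt0r y0 rnorm_ge0.
  rewrite -(ler_pM2l yp) -expr2 -(rdotxx dot_norm) -SP.
  apply: (le_trans (ler_norm _)); apply: (le_trans (rdot_le dot_norm _ _)).
  by rewrite mulrCA mulrA ler_wpM2r ?rnorm_ge0// le_opnorm.
have bS : S \in @bounded_linear R H H.
  apply/bounded_linearP; split; last by exists (opnorm T).
  by move=> a x y; rewrite SD SZ.
exists (Bop bS); split; first by move=> x y; rewrite SP.
apply: opnorm_le => y y1; apply: (le_trans (SM y)).
by rewrite ler_piMr ?opnorm_ge0.
Qed.

Lemma adjoint_pair_unique T S S' :
  adjoint_pair dot T S -> adjoint_pair dot T S' -> S = S'.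
Proof.
move=> TS TS'; apply/val_inj/funext => y; apply: (rdot_inj dot_norm) => x.
by rewrite -TS -TS'.
Qed.

Lemma adjoint_pairP (T S : bop H H) : adjoint_pair dot T S <->
  (forall x y, dot (T x) y = dot x (S y)).
Proof.
split=> [TS x y|TS x y]; last by rewrite /rdot TS.
by apply: dot_rdotE; [exact: TS|rewrite -bopZ; exact: TS].
Qed.

Lemma adjointP (T : bop H H) : adjoint_pair dot T (adjoint dot T).
Proof.
have [S [TS _]] := adjoint_exists T; apply/adjoint_pairP.
apply: (@xgetPex _ _ [set S : bop H H | forall x y, dot (T x) y = dot x (S y)]).
by exists S; exact/adjoint_pairP.
Qed.

Lemma adjointE T S : adjoint_pair dot T S -> adjoint dot T = S.
Proof. exact/adjoint_pair_unique/adjointP. Qed.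

Lemma adjoint_pairC T S : adjoint_pair dot T S -> adjoint_pair dot S T.
Proof. by move=> TS x y; rewrite rdotC -TS rdotC. Qed.

Lemma adjointK T : adjoint dot (adjoint dot T) = T.
Proof. exact/adjointE/adjoint_pairC/adjointP. Qed.

Lemma opnorm_adjoint T : opnorm (adjoint dot T) <= opnorm T.
Proof. by have [S [/adjointE -> ]] := adjoint_exists T. Qed.

Lemma adjoint_linear (a : R[i]) T S :
  adjoint dot (a *: T + S) = a^* *: adjoint dot T + adjoint dot S.
Proof.
apply/adjointE/adjoint_pairP => x y.
have /adjoint_pairP TP := adjointP T; have /adjoint_pairP SP := adjointP S.
have -> : (a *: T + S) x = a *: T x + S x by [].
have -> : (a^* *: adjoint dot T + adjoint dot S) y =
  a^* *: adjoint dot T y + adjoint dot S y by [].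
rewrite linearPl linearPr /= TP SP; congr (_ * _ + _).
exact: (esym (conjcK a)).
Qed.

End riesz.

(** * Square-summable families and their operators *)

Section ell2_theory.
Context {R : realType} {I : choiceType} {H : normedModType R[i]}.
Implicit Types (g h : ell2 I H) (F : {fset I}).

Lemma ell2E g : rnorm g = ell2norm g. Proof. by []. Qed.

Lemma sqsum_fsetP (g : I -> H) (M : R) : (sqsum g <= M%:E)%E <->
  forall F, \sum_(i <- F) rnorm (g i) ^+ 2 <= M.
Proof.
rewrite sqsum_leP; split=> gM F => [|finF]; last by rewrite (fsbig_finite _ _ finF) gM.
have finF : finite_set [set` F] by exact: finite_fset.
by have := gM _ finF; rewrite (fsbig_finite _ _ finF) set_fsetK.
Qed.

Lemma ell2_sum_le g F : \sum_(i <- F) rnorm (g i) ^+ 2 <= rnorm g ^+ 2.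
Proof. by move: F; apply/sqsum_fsetP; rewrite ell2normE. Qed.

Lemma ell2_coord_le g i : rnorm (g i) <= rnorm g.
Proof.
rewrite -(ler_pXn2r (ltn0Sn 1)) ?nnegrE ?rnorm_ge0//.
by have := ell2_sum_le g [fset i]%fset; rewrite big_seq_fset1.
Qed.

Lemma ell2_rnorm_le g M : 0 <= M ->
  (forall F, \sum_(i <- F) rnorm (g i) ^+ 2 <= M ^+ 2) -> rnorm g <= M.
Proof. by move=> M0 gM; apply: ell2norm_le => //; apply/sqsum_fsetP. Qed.

Lemma ell2_of (g : I -> H) M : 0 <= M ->
  (forall F, \sum_(i <- F) rnorm (g i) ^+ 2 <= M ^+ 2) ->
  exists G : ell2 I H, (forall i, G i = g i) /\ rnorm G <= M.
Proof.
move=> M0 gM; have gS : g \in @square_summable R I H.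
  by apply/square_summableP; exists (M ^+ 2); apply/sqsum_fsetP.
by exists (Ell2 gS); split=> //; exact: ell2_rnorm_le.
Qed.

Lemma ell2_real_sum g : real_sum (fun i => rnorm (g i) ^+ 2) (rnorm g ^+ 2).
Proof.
apply: nneg_real_sum => [i|F|e e0]; [exact: sqr_ge0|exact: ell2_sum_le|].
apply: contrapT => /forallNP nF.
have : (sqsum g <= (rnorm g ^+ 2 - e)%:E)%E.
  by apply/sqsum_fsetP => F; rewrite leNgt; apply/negP/nF.
by rewrite ell2normE lee_fin -ell2E; lra.
Qed.

Lemma ell2P g h : (forall i, g i = h i) -> g = h.
Proof. by move=> gh; apply/val_inj/funext. Qed.

Lemma ell2D g h i : (g + h) i = g i + h i. Proof. by []. Qed.
Lemma ell2Z (a : R[i]) g i : (a *: g) i = a *: g i. Proof. by []. Qed.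
Lemma ell2B g h i : (g - h) i = g i - h i. Proof. by []. Qed.

Lemma ell2_sum (J : Type) (r : seq J) (f : J -> ell2 I H) i :
  (\sum_(j <- r) f j) i = \sum_(j <- r) f j i.
Proof. by elim/big_rec2 : _ => // j a b _ <-. Qed.

Definition delta_fun l (x : H) : I -> H := fun k => if k == l then x else 0.

Lemma delta_fun_sum_le l x F : \sum_(i <- F) rnorm (delta_fun l x i) ^+ 2 <= rnorm x ^+ 2.
Proof.
have E i : i != l -> rnorm (delta_fun l x i) ^+ 2 = 0.
  by rewrite /delta_fun => /negPf ->; rewrite rnorm0 expr0n.
have [lF|lF] := boolP (l \in F).
  rewrite (big_fsetD1 l)//= big_seq big1 ?addr0 /delta_fun ?eqxx// => i.
  by rewrite !inE => /andP[il _]; exact: E.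
rewrite big_seq big1 ?sqr_ge0// => i iF; apply: E.
by apply: contraNneq lF => <-.
Qed.

Lemma delta_fun_summable l x : delta_fun l x \in @square_summable R I H.
Proof.
apply/square_summableP; exists (rnorm x ^+ 2); apply/sqsum_fsetP => F.
exact: delta_fun_sum_le.
Qed.

Definition delta l x : ell2 I H := Ell2 (delta_fun_summable l x).

Lemma deltaE l x k : delta l x k = if k == l then x else 0. Proof. by []. Qed.

Lemma rnorm_delta l x : rnorm (delta l x) = rnorm x.
Proof.
apply/eqP; rewrite eq_le; apply/andP; split; last first.
  by have := ell2_coord_le (delta l x) l; rewrite deltaE eqxx.
by apply: ell2_rnorm_le => [|F]; [exact: rnorm_ge0|exact: delta_fun_sum_le].
Qed.

Lemma delta_linear l a x y : delta l (a *: x + y) = a *: delta l x + delta l y.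
Proof.
apply: ell2P => k; rewrite ell2D ell2Z !deltaE; case: eqP => //.
by rewrite scaler0 addr0.
Qed.

(** The squared distance from g to its restriction to G is the part of the squared
    norm of g carried by the complement of G. *)
Lemma delta_has_sum g : has_sum (fun l => delta l (g l)) g.
Proof.
apply/has_sumP => e e0.
have e20 : 0 < (e / 2) ^+ 2 by rewrite exprn_gt0// divr_gt0.
have [F FP] := ell2_real_sum g e20; exists F => G FG.
apply: (@le_lt_trans _ _ (e / 2)); last by lra.
have GE k : (\sum_(l <- G) delta l (g l)) k = if k \in G then g k else 0.
  rewrite ell2_sum; case: ifPn => kG.
    rewrite (big_fsetD1 k kG) deltaE eqxx big_seq big1 => [|i]; first exact: addr0.
    by rewrite !inE eq_sym deltaE => /andP[/negPf -> _].
  rewrite big_seq big1// => i iG; rewrite deltaE; case: eqP => // ki.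
  by rewrite ki iG in kG.
apply: ell2_rnorm_le => [|S]; first by rewrite divr_ge0// ltW.
apply: (@le_trans _ _ (\sum_(k <- (G `|` S)%fset)
    rnorm ((g - \sum_(l <- G) delta l (g l)) k) ^+ 2)).
  by apply: ler_sum_fset => [i|]; [exact: sqr_ge0|exact: fsubsetUr].
rewrite (sum_fsetID _ (fsubsetUl G S)) big_seq big1 ?add0r; last first.
  by move=> k kG; rewrite ell2B GE kG subrr rnorm0 expr0n.
rewrite (eq_big_seq (fun k => rnorm (g k) ^+ 2)); last first.
  by move=> k; rewrite ell2B GE !inE => /andP[/negPf -> _]; rewrite subr0.
have := ell2_sum_le g (G `|` S)%fset; rewrite (sum_fsetID _ (fsubsetUl G S)).
have := FP G FG; rewrite ltr_norml => /andP[_]; lra.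
Qed.

End ell2_theory.

Section operators.
Context {R : realType} {U V W : normedModType R[i]}.

Lemma bop0 (T : bop V W) : T 0 = 0.
Proof. by rewrite -(scale0r 0) bopZ scale0r. Qed.

Lemma bopN (T : bop V W) x : T (- x) = - T x.
Proof. by rewrite -scaleN1r bopZ scaleN1r. Qed.

Lemma bopB (T : bop V W) x y : T (x - y) = T x - T y.
Proof. by rewrite bopD bopN. Qed.

Lemma bop_compP (T : bop V W) (S : bop U V) : (fun x => T (S x)) \in @bounded_linear R U W.
Proof.
apply/bounded_linearP; split; first by move=> a x y; rewrite !(bopD, bopZ).
exists (opnorm T * opnorm S) => x; apply: (le_trans (le_opnorm _ _)).
by rewrite -mulrA ler_wpM2l ?opnorm_ge0// le_opnorm.
Qed.

Definition bop_comp T S : bop U W := Bop (bop_compP T S).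

Lemma opnorm_comp T S : opnorm (bop_comp T S) <= opnorm T * opnorm S.
Proof.
apply: opnorm_le => x x1; apply: (le_trans (le_opnorm T (S x))).
by rewrite ler_wpM2l ?opnorm_ge0// opnorm_ub.
Qed.

Lemma opnorm_le_bound (T : bop V W) M : 0 <= M ->
  (forall x, rnorm (T x) <= M * rnorm x) -> opnorm T <= M.
Proof.
move=> M0 TM; apply: opnorm_le => x x1; apply: (le_trans (TM x)).
by rewrite ler_piMr.
Qed.

Lemma bopDE (T S : bop V W) x : (T + S) x = T x + S x. Proof. by []. Qed.

Lemma bopZE (a : R[i]) (T : bop V W) x : (a *: T) x = a *: T x. Proof. by []. Qed.

Lemma eq_bop (T S : bop V W) : (forall x, T x = S x) -> T = S.
Proof. by move=> TS; apply/val_inj/funext. Qed.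

End operators.

Lemma bop_shift_comm {R : realType} {V : normedModType R[i]} (T : bop V V) (w z : R[i]) x :
  T (T x - z *: x) - w *: (T x - z *: x) = T (T x - w *: x) - z *: (T x - w *: x).
Proof.
rewrite !bopB !bopZ !scalerBr !scalerA (mulrC z).
rewrite !opprB !addrA [LHS]addrAC [RHS]addrAC; congr (_ + _).
exact: addrAC.
Qed.

Section entries.
Context {R : realType} {I : choiceType} {H : normedModType R[i]}.
Local Notation L := (ell2 I H).
Implicit Types T S : bop L L.

Lemma entry_bounded T k l : (fun x => T (delta l x) k) \in @bounded_linear R H H.
Proof.
apply/bounded_linearP; split; first by move=> a x y; rewrite delta_linear bopD bopZ.
exists (opnorm T) => x; apply: (le_trans (ell2_coord_le _ _)).
by rewrite (le_trans (le_opnorm _ _))// rnorm_delta.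
Qed.

Definition entry T : opmx I H := fun k l => Bop (entry_bounded T k l).

Lemma opnorm_entry T k l : opnorm (entry T k l) <= opnorm T.
Proof.
apply: opnorm_le_bound => [|x]; first exact: opnorm_ge0.
apply: (le_trans (ell2_coord_le _ _)).
by rewrite (le_trans (le_opnorm _ _))// rnorm_delta.
Qed.

Lemma entry_represents T : represents (entry T) T.
Proof.
move=> g k; apply: (@has_sum_map _ _ _ _ (fun h => T h k) (opnorm T)) => //.
- by move=> x y; rewrite bopD.
- by move=> x; apply: (le_trans (ell2_coord_le _ _)); exact: le_opnorm.
- exact: delta_has_sum.
Qed.

Lemma represents_entry (A : opmx I H) T : represents A T -> entry T = A.
Proof.
move=> AT; apply/funext => k; apply/funext => l; apply: eq_bop => x /=.
apply: (has_sum_unique (AT (delta l x) k)).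
have -> : A k l x = A k l (delta l x l) by rewrite deltaE eqxx.
apply: (@has_sum_single _ _ _ (fun l' => A k l' (delta l x l'))) => j jl.
by rewrite deltaE (negPf jl) bop0.
Qed.

Lemma represents_unique (A : opmx I H) T S : represents A T -> represents A S -> T = S.
Proof.
move=> AT AS; apply: eq_bop => g; apply: ell2P => k.
exact: (has_sum_unique (AT g k) (AS g k)).
Qed.

(** The (k, l) entry of the matrix product is the representation formula of T at the
    vector S (delta l x): the algebra laws pass from operators to matrices without
    any exchange of summations. *)
Lemma opmx_mul_entry T S : opmx_mul (entry T) (entry S) = entry (bop_comp T S).
Proof.
apply/funext => k; apply/funext => l; rewrite /opmx_mul.
have TS x : has_sum (fun n => entry T k n (entry S n l x)) (entry (bop_comp T S) k l x).
  exact: (@entry_represents T (S (delta l x)) k).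
set P := [set U : bop H H | _].
have /(_ (entry (bop_comp T S) k l)) : forall U, P U -> P (xget 0 P).
  by move=> U PU; apply: (@xgetPex _ _ P); exists U.
move=> /(_ TS) PX; apply: eq_bop => x; exact: (has_sum_unique (PX x) (TS x)).
Qed.

End entries.

Section ell2_inner_product.
Context {R : realType} {I : choiceType} {H : normedModType R[i]} (dot : {dot H for Num.conj}).
Hypothesis dot_norm : forall x : H, `|x| ^+ 2 = dot x x.
Local Notation L := (ell2 I H).
Implicit Types g h : L.
Local Notation rdot := (rdot dot).

(** The real inner product of [ell2], defined by polarization so that it is total;
    [rip_real_sum] identifies it with the sum of the inner products of coordinates. *)
Definition rip g h : R := (rnorm (g + h) ^+ 2 - rnorm g ^+ 2 - rnorm h ^+ 2) / 2.

Lemma rip_real_sum g h : real_sum (fun i => rdot (g i) (h i)) (rip g h).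
Proof.
have E x y : rdot x y =
    2^-1 * (rnorm (x + y) ^+ 2 + (-1 * rnorm x ^+ 2 + -1 * rnorm y ^+ 2)).
  by rewrite -!(rdotxx dot_norm) rdotDl !rdotDr (rdotC dot y x); field.
have -> : rip g h = 2^-1 * (rnorm (g + h) ^+ 2 + (-1 * rnorm g ^+ 2 + -1 * rnorm h ^+ 2)).
  by rewrite /rip; field.
rewrite (_ : (fun i => _) = fun i =>
  2^-1 * (rnorm ((g + h) i) ^+ 2 + (-1 * rnorm (g i) ^+ 2 + -1 * rnorm (h i) ^+ 2))).
  apply/real_sumZ/real_sumD; first exact: ell2_real_sum.
  by apply: real_sumD; apply: real_sumZ; exact: ell2_real_sum.
by apply/funext => i; rewrite E.
Qed.

Lemma ripC g h : rip g h = rip h g.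
Proof. by rewrite /rip (addrC h); ring. Qed.

Lemma ripDl g g' h : rip (g + g') h = rip g h + rip g' h.
Proof.
apply: (real_sum_unique (rip_real_sum (g + g') h)).
rewrite (_ : (fun i => _) = fun i => rdot (g i) (h i) + rdot (g' i) (h i)).
  by apply: real_sumD; exact: rip_real_sum.
by apply/funext => i; rewrite rdotDl.
Qed.

Lemma ripZl (t : R) g h : rip (t%:C *: g) h = t * rip g h.
Proof.
apply: (real_sum_unique (rip_real_sum (t%:C *: g) h)).
rewrite (_ : (fun i => _) = fun i => t * rdot (g i) (h i)).
  by apply: real_sumZ; exact: rip_real_sum.
by apply/funext => i; rewrite rdotZl.
Qed.

Lemma rip_skew g h : rip ('i%C *: g) h = - rip g ('i%C *: h).
Proof.
apply: (real_sum_unique (rip_real_sum ('i%C *: g) h)).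
rewrite (_ : (fun i => _) = fun i => -1 * rdot (g i) (('i%C *: h : L) i)).
  by rewrite -(mulN1r (rip _ _)); apply: real_sumZ; exact: rip_real_sum.
by apply/funext => i; rewrite mulN1r rdot_skew.
Qed.

Lemma ripxx g : rip g g = rnorm g ^+ 2.
Proof.
apply: (real_sum_unique (rip_real_sum g g)).
rewrite (_ : (fun i => _) = fun i => rnorm (g i) ^+ 2); first exact: ell2_real_sum.
by apply/funext => i; rewrite (rdotxx dot_norm).
Qed.

Lemma rip_le g h : `|rip g h| <= rnorm g * rnorm h.
Proof.
exact: (form_cauchy_schwarz ripC ripDl ripZl ripxx (@rnorm_ge0 _ _) (@rnorm0_eq0 _ _)).
Qed.

Lemma rnorm_sqrD g h (t : R) :
  rnorm (g + t%:C *: h) ^+ 2 = rnorm g ^+ 2 + 2 * t * rip g h + t ^+ 2 * rnorm h ^+ 2.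
Proof. exact: (form_sqrD ripC ripDl ripZl ripxx). Qed.

Lemma rip_delta g l x : rip g (delta l x) = rdot (g l) x.
Proof.
apply: (real_sum_unique (rip_real_sum g (delta l x))) => e e0.
exists [fset l]%fset => G lG; rewrite (sum_fsetID _ lG) big_seq_fset1 deltaE eqxx.
rewrite big_seq_cond big1 ?addr0 ?subrr ?normr0// => i; rewrite !inE => /andP[/andP[il _] _].
by rewrite deltaE (negPf il) -(scale0r (0 : H)) (rdotZr dot 0) mul0r.
Qed.

(** By continuity in h it suffices to take h = delta l x, where both sides are the sum
    over k of the pairings of A l k (g k) with x. *)
Lemma rip_adjoint (A B : opmx I H) (T S : bop L L) :
  represents A T -> represents B S ->
  (forall k l, adjoint_pair dot (A k l) (B l k)) ->
  forall g h, rip (T g) h = rip g (S h).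
Proof.
move=> AT BS AB g h.
have E l x : rip (T g) (delta l x) = rip g (S (delta l x)).
  rewrite rip_delta; apply: (real_sum_unique _ (rip_real_sum _ _)).
  have Tl := @real_sum_map _ _ _ (fun y => rdot y x) (rnorm x) _ _
    (fun y z => rdotDl dot y z x) _ (AT g l).
  rewrite (_ : (fun i => _) = fun k => rdot (A l k (g k)) x).
    by apply: Tl => y; rewrite mulrC; exact: rdot_le.
  apply/funext => k; rewrite (AB l k).
  by rewrite -[S (delta l x) k]/(entry S k l x) (represents_entry BS).
have M1 := @real_sum_map _ _ _ (rip (T g)) (rnorm (T g)) _ _ _ _ (@delta_has_sum _ _ _ h).
have M2 := @real_sum_map _ _ _ (fun h => rip g (S h)) (rnorm g * opnorm S) _ _ _ _ (@delta_has_sum _ _ _ h).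
apply: (real_sum_unique (M1 _ _)).
- by move=> x y; rewrite !(ripC (T g)) ripDl.
- by move=> x; exact: rip_le.
rewrite (_ : (fun i => _) = fun l => rip g (S (delta l (h l)))); last first.
  by apply/funext => l; exact: E.
apply: M2.
- by move=> x y; rewrite bopD !(ripC g) ripDl.
- move=> x; apply: (le_trans (rip_le _ _)).
  by rewrite -mulrA ler_wpM2l ?rnorm_ge0// le_opnorm.
Qed.

End ell2_inner_product.

(** * Polynomial weights on relatively separated sets *)

Section weights.
Context {R : realType} {d : nat}.
Implicit Types x y : 'rV[R]_d.

Lemma euclid_norm_ge0 x : 0 <= euclid_norm x. Proof. exact: sqrtr_ge0. Qed.

Lemma euclid_normN x : euclid_norm (- x) = euclid_norm x.
Proof. by rewrite /euclid_norm; congr Num.sqrt; apply: eq_bigr => i _; rewrite mxE sqrrN. Qed.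

Lemma euclid_norm_sqr x : euclid_norm x ^+ 2 = \sum_(i < d) x 0 i ^+ 2.
Proof. by rewrite sqr_sqrtr// sumr_ge0// => i _; exact: sqr_ge0. Qed.

Lemma coord_le_euclid_norm x i : `|x 0 i| <= euclid_norm x.
Proof.
rewrite -(ler_pXn2r (ltn0Sn 1)) ?nnegrE ?euclid_norm_ge0// real_normK ?num_real//.
rewrite euclid_norm_sqr (bigD1 i)//= lerDl sumr_ge0// => j _; exact: sqr_ge0.
Qed.

Lemma euclid_norm0 : euclid_norm (0 : 'rV[R]_d) = 0.
Proof. by rewrite /euclid_norm big1 ?sqrtr0// => i _; rewrite mxE expr0n. Qed.

(** From |x + y|^2 <= 2|x|^2 + 2|y|^2; the constant is harmless and the triangle
    inequality is avoided. *)
Lemma euclid_normD_le x y : euclid_norm (x + y) <= 2 * Num.max (euclid_norm x) (euclid_norm y).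
Proof.
set m := Num.max _ _.
have xm : euclid_norm x <= m by rewrite le_max lexx.
have ym : euclid_norm y <= m by rewrite le_max lexx orbT.
have m0 : 0 <= m := le_trans (euclid_norm_ge0 x) xm.
rewrite -(ler_pXn2r (ltn0Sn 1)) ?nnegrE ?euclid_norm_ge0 ?mulr_ge0//.
apply: (@le_trans _ _ (2 * euclid_norm x ^+ 2 + 2 * euclid_norm y ^+ 2)).
  rewrite !euclid_norm_sqr !mulr_sumr -big_split/=; apply: ler_sum => i _.
  by rewrite mxE; have := sqr_ge0 (x 0 i - y 0 i); lra.
have sq a : 0 <= a -> a <= m -> a ^+ 2 <= m ^+ 2 by move=> a0 am; rewrite ler_pXn2r.
have := sq _ (euclid_norm_ge0 x) xm; have := sq _ (euclid_norm_ge0 y) ym.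
rewrite exprMn; lra.
Qed.

Lemma nu_gt0 s x : 0 < nu s x.
Proof. by rewrite powR_gt0// ltr_pwDl// euclid_norm_ge0. Qed.

Lemma nuN s x : nu s (- x) = nu s x. Proof. by rewrite /nu euclid_normN. Qed.

Lemma nu0 s : nu s (0 : 'rV[R]_d) = 1.
Proof. by rewrite /nu euclid_norm0 addr0 powR1. Qed.

Lemma nu_ge1 s x : 0 <= s -> 1 <= nu s x.
Proof.
move=> s0; apply: (@le_trans _ _ (1 `^ s)); first by rewrite powR1.
apply: ge0_ler_powR => //; rewrite ?nnegrE//.
  by rewrite addr_ge0// euclid_norm_ge0.
by rewrite lerDl euclid_norm_ge0.
Qed.

Lemma nuD_le s x y : 0 <= s -> nu s (x + y) <= 2 `^ s * (nu s x + nu s y).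
Proof.
move=> s0; set m := Num.max (euclid_norm x) (euclid_norm y).
have m0 : 0 <= m by rewrite le_max euclid_norm_ge0.
have nm : (1 + m) `^ s <= nu s x + nu s y.
  have [mE|mE] : m = euclid_norm x \/ m = euclid_norm y.
    by rewrite /m; case: leP; [right|left].
  - by rewrite mE lerDl ltW// nu_gt0.
  - by rewrite mE lerDr ltW// nu_gt0.
apply: (@le_trans _ _ ((2 * (1 + m)) `^ s)).
  apply: ge0_ler_powR => //; rewrite ?nnegrE ?addr_ge0 ?mulr_ge0 ?addr_ge0 ?euclid_norm_ge0//.
  have := euclid_normD_le x y; rewrite -/m; lra.
by rewrite powRM ?addr_ge0// ler_wpM2l// powR_ge0.
Qed.

Lemma dyadic_shell (y : R) : 1 <= y -> exists j, 2 ^+ j <= y /\ y < 2 ^+ j.+1.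
Proof.
move=> y1; have y0 : 0 <= y by apply: le_trans y1.
have /andP[ty yt] := truncn_itv y0.
have t0 : (0 < Num.trunc y)%N by rewrite truncn_ge_nat.
have [j] := unstable.leq_ltn_expn (Num.trunc y).-1; rewrite prednK// => /andP[jt tj].
exists j; rewrite -!natrX; split; first by rewrite (le_trans _ ty)// ler_nat.
by rewrite (lt_le_trans yt)// ler_nat.
Qed.

Section separated.
Variables (X : set 'rV[R]_d) (N : nat).
Hypothesis XN : forall x, (X `&` unit_cube x #<= `I_N)%card.

Lemma card_unit_cube x (G : {fset X}) : (forall n, n \in G -> unit_cube x (val n)) ->
  (#|` G| <= N)%N.
Proof.
move=> Gx; pose V := [fset val n | n in G]%fset.
have <- : #|` V| = #|` G| by rewrite card_imfset//=; exact: val_inj.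
have : ([set` V] #= `I_#|` V|)%card by exact/card_eq_fsetP.
rewrite card_eq_le => /andP[_ leV]; rewrite -card_le_II.
apply: (card_le_trans leV); apply: card_le_trans (XN x); apply: subset_card_le.
by move=> _ /= /imfsetP[n /= nG ->]; split; [exact: set_valP|exact: Gx].
Qed.

(** The ball of integer radius r is covered by (2r)^d unit cubes. *)
Lemma card_ball x (r : nat) (F : {fset X}) :
  (\sum_(n <- F | (euclid_norm (val n - x) < r%:R)%R) 1 <= N * (2 * r) ^ d)%N.
Proof.
have [r0|r0] := posnP r.
  by rewrite big1// => n; rewrite r0 ltNge euclid_norm_ge0.
pose c (n : X) : {ffun 'I_d -> 'I_(2 * r).-1.+1} :=
  [ffun i => inord (Num.trunc ((val n - x) 0 i + r%:R))].
rewrite (partition_big c predT)//=.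
apply: (@leq_trans (\sum_(m : {ffun 'I_d -> 'I_(2 * r).-1.+1}) N)); last first.
  by rewrite sum_nat_const card_ffun !card_ord prednK ?muln_gt0// mulnC.
apply: leq_sum => m _; rewrite big_fset_condE -card_fset_sum1.
apply: (@card_unit_cube (\row_i (x 0 i - r%:R + (m i)%:R))) => n.
rewrite !inE => /andP[_ /andP[nr /eqP nm]] i; rewrite mxE -nm ffunE.
have := le_lt_trans (coord_le_euclid_norm (val n - x) i) nr.
rewrite ltr_norml => /andP[lo hi].
have y0 : 0 <= (val n - x) 0 i + r%:R by rewrite -lerBlDr sub0r ltW.
have /andP[ty yt] := truncn_itv y0.
rewrite inordK.
  move: ty yt; rewrite -natr1 !mxE; lra.
rewrite prednK ?muln_gt0// -(ltr_nat R) (le_lt_trans ty)// natrM.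
lra.
Qed.

(** On the dyadic shell 2^j <= 1 + |n - x| < 2^(j+1) each term is at most 2^(-jt), and
    the shell has at most N 4^d 2^(jd) points: the sum is dominated by a geometric
    series of ratio 2^(d - t). *)
Lemma sum_nuV_le t : d%:R < t -> exists2 C, 0 < C &
  forall x (F : {fset X}), \sum_(n <- F) (nu t (val n - x))^-1 <= C.
Proof.
move=> dt; have t0 : 0 <= t by rewrite (le_trans _ (ltW dt)).
pose q : R := 2 ^+ d / 2 `^ t.
have p0 : 0 < 2 `^ t :> R by exact: powR_gt0.
have q0 : 0 <= q by rewrite divr_ge0 ?exprn_ge0// ltW.
have q1 : q < 1.
  rewrite ltr_pdivrMr// mul1r -powR_mulrn//.
  by rewrite /powR gt_eqF// ltr_expR ltr_pM2r// ln_gt0// ltr1n.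
exists (N.+1%:R * 4 ^+ d / (1 - q)).
  by rewrite divr_gt0 ?subr_gt0// mulr_gt0// exprn_gt0.
move=> x F.
have shell (n : X) : exists j, 2 ^+ j <= 1 + euclid_norm (val n - x) /\
    1 + euclid_norm (val n - x) < 2 ^+ j.+1.
  by apply: dyadic_shell; rewrite lerDl euclid_norm_ge0.
pose j n := projT1 (cid (shell n)).
have jP n := projT2 (cid (shell n)) : 2 ^+ j n <= _ /\ _ < 2 ^+ (j n).+1.
pose J := (\max_(n <- F) j n).+1.
have nuj n : (nu t (val n - x))^-1 <= (2 `^ t) ^- j n.
  rewrite lef_pV2 ?posrE ?nu_gt0 ?exprn_gt0// -powR_mulrn ?(ltW p0)// powRAC powR_mulrn//.
  by apply: ge0_ler_powR => //; rewrite ?nnegrE ?exprn_ge0 ?addr_ge0 ?euclid_norm_ge0//; exact: (jP n).1.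
apply: (@le_trans _ _ (\sum_(n <- F) \sum_(i < J)
    if euclid_norm (val n - x) < (2 ^ i.+1)%:R then (2 `^ t) ^- i else 0)).
  rewrite big_seq [leRHS]big_seq; apply: ler_sum => n nF.
  have jJ : (j n < J)%N by rewrite ltnS (big_fsetD1 n)//= leq_maxl.
  rewrite (bigD1 (Ordinal jJ))//= natrX ifT; last first.
    by apply: le_lt_trans (jP n).2; rewrite lerDr.
  rewrite (le_trans (nuj n))// lerDl sumr_ge0// => i _; case: ifP => // _.
rewrite exchange_big/=.
apply: (@le_trans _ _ (\sum_(i < J) N.+1%:R * 4 ^+ d * q ^+ i)).
  apply: ler_sum => i _; rewrite -big_mkcond/= big_const_seq iter_addr_0.
  have := card_ball x (2 ^ i.+1) F; rewrite sum1_count => cF.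
  rewrite -[leLHS]mulr_natl.
  apply: (@le_trans _ _ ((N * (2 * 2 ^ i.+1) ^ d)%:R * (2 `^ t) ^- i)).
    by rewrite ler_wpM2r ?ler_nat// invr_ge0 exprn_ge0// ltW.
  rewrite expr_div_n mulrA ler_wpM2r ?invr_ge0 ?exprn_ge0 ?(ltW p0)//.
  rewrite natrM -mulrA ler_pM ?ler0n ?ler_nat//.
  rewrite natrX natrM natrX exprS mulrA -natrM exprMn.
  by rewrite -!exprM mulnC.
rewrite -mulr_sumr ler_wpM2l ?mulr_ge0 ?exprn_ge0//.
rewrite -div1r ler_pdivlMr ?subr_gt0// mulrC.
have := subrX1 q J => /(congr1 -%R); rewrite opprB -mulNr opprB => <-.
by rewrite gerBl exprn_ge0.
Qed.

End separated.
End weights.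

(** * Off-diagonal decay *)

Section complete_operators.
Context {R : realType} {V : normedModType R[i]} {W : completeNormedModType R[i]}.

Lemma bopBE (T S : bop V W) x : (T - S) x = T x - S x. Proof. by []. Qed.

(** The pointwise limit is approached uniformly on the unit ball, hence is linear and
    bounded. *)
Lemma bop_cauchy_cvg (u : nat -> bop V W) :
  (forall e : R, 0 < e -> exists N, forall m n, (N <= m)%N -> (N <= n)%N ->
    opnorm (u m - u n) < e) ->
  exists T, forall e : R, 0 < e -> exists N, forall n, (N <= n)%N ->
    opnorm (u n - T) <= e.
Proof.
move=> uC.
have uxC x : exists v, forall e : R, 0 < e -> exists N, forall n, (N <= n)%N ->
    rnorm (u n x - v) < e.
  apply: rnorm_cauchy_cvg => e e0.
  have x0 : 0 < rnorm x + 1 by rewrite ltr_wpDl// rnorm_ge0.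
  have [|N NP] := uC (e / (rnorm x + 1)); first by rewrite divr_gt0.
  exists N => m n Nm Nn; rewrite -bopBE (le_lt_trans (le_opnorm _ _))//.
  apply: (@le_lt_trans _ _ (opnorm (u m - u n) * (rnorm x + 1))).
    by rewrite ler_wpM2l ?opnorm_ge0// lerDl.
  by rewrite -ltr_pdivlMr// NP.
pose L x := projT1 (cid (uxC x)).
have LP x : forall e : R, 0 < e -> exists N, forall n, (N <= n)%N ->
    rnorm (u n x - L x) < e by exact: (projT2 (cid (uxC x))).
have uL (e : R) : 0 < e -> exists N, forall n, (N <= n)%N -> forall x,
    rnorm (u n x - L x) <= e * rnorm x.
  move=> e0; have [N NP] := uC e e0; exists N => n Nn x.
  apply/ler_addgt0Pr => r r0; have [N' N'P] := LP x r r0.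
  pose m := maxn N N'; have := N'P m (leq_maxr _ _) => A.
  have -> : u n x - L x = (u n - u m) x + (u m x - L x).
    by rewrite bopBE addrA subrK.
  apply: (le_trans (ler_rnormD _ _)); apply: lerD; last exact: ltW.
  apply: (le_trans (le_opnorm _ _)); rewrite ler_wpM2r ?rnorm_ge0//.
  by rewrite ltW// NP// leq_maxl.
have bL : L \in @bounded_linear R V W.
  apply/bounded_linearP; split.
    move=> a x y; apply/eqP; rewrite -subr_eq0; apply/eqP/rnorm0_eq0/eqP.
    rewrite eq_le rnorm_ge0 andbT; apply/ler_addgt0Pr => e e0; rewrite add0r.
    pose K := rnorm (a *: x + y) + complex.Re `|a| * rnorm x + rnorm y + 1.
    have K0 : 0 < K.
      by rewrite ltr_wpDl// !addr_ge0 ?mulr_ge0 ?rnorm_ge0 ?Re_norm_ge0.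
    have [|N NP] := uL (e / K); first by rewrite divr_gt0.
    have {}NP := NP N (leqnn N).
    have -> : L (a *: x + y) - (a *: L x + L y) =
        (a *: (u N x - L x) + (u N y - L y)) - (u N (a *: x + y) - L (a *: x + y)).
      rewrite bopD bopZ scalerBr -[in RHS]addrACA -opprD.
      by rewrite [in RHS]opprB [RHS]addrC addrA subrK.
    rewrite (le_trans (ler_rnormD _ _))// rnormN.
    apply: (le_trans (lerD (ler_rnormD _ _) (NP _))); rewrite rnormZ.
    apply: (@le_trans _ _ (e / K * (K - 1))).
      rewrite /K; have := ler_wpM2l (Re_norm_ge0 a) (NP x); have := NP y; lra.
    rewrite mulrAC ler_pdivrMr// ler_wpM2l ?(ltW e0)//; lra.
  have [N NP] := uL 1 ltr01; exists (opnorm (u N) + 1) => x.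
  have -> : L x = u N x - (u N x - L x) by rewrite opprB addrC subrK.
  rewrite (le_trans (ler_rnormD _ _))// rnormN mulrDl.
  by rewrite lerD ?le_opnorm// NP.
exists (Bop bL) => e e0; have [N NP] := uL e e0; exists N => n Nn.
by apply: opnorm_le_bound => [|x]; [exact: ltW|exact: NP].
Qed.

End complete_operators.

Section off_diagonal_decay.
Context {R : realType} {d : nat} {X : set 'rV[R]_d} {H : completeNormedModType R[i]}.
Local Notation L := (ell2 X H).
Implicit Types (A B : opmx X H) (k l n : X) (F : {fset X}).

Definition weight t k l : R := (nu t (val k - val l))^-1.

Definition decay t a A := forall k l, opnorm (A k l) <= a * weight t k l.

Lemma weightC t k l : weight t k l = weight t l k.
Proof. by rewrite /weight -nuN opprB. Qed.

Lemma weight_ge0 t k l : 0 <= weight t k l.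
Proof. by rewrite invr_ge0 ltW// nu_gt0. Qed.

Lemma decay_weaken t a b A : a <= b -> decay t a A -> decay t b A.
Proof. by move=> ab dA k l; rewrite (le_trans (dA k l))// ler_wpM2r// weight_ge0. Qed.

Definition summable_weight t W :=
  0 < W /\ forall k F, \sum_(l <- F) weight t k l <= W.

Lemma ex_summable_weight t : relatively_separated X -> d%:R < t ->
  exists W, summable_weight t W.
Proof.
move=> [N XN] dt; have [C C0 CP] := sum_nuV_le XN dt.
by exists C; split=> // k F; under eq_bigr do rewrite weightC; exact: CP.
Qed.

(** Schur test: the rows of A are absolutely summable against g; the Cauchy-Schwarz
    inequality with the weights of a row, followed by summation over the columns,
    bounds the image in [ell2]. *)
Lemma decay_represents t W a A : summable_weight t W -> 0 <= a -> decay t a A ->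
  exists T : bop L L, represents A T /\ opnorm T <= a * W.
Proof.
move=> [W0 wW] a0 dA.
have ex (g : L) k : exists v, has_sum (fun l => A k l (g l)) v.
  apply: (@summable_has_sum _ _ _ _ (a * W * rnorm g)) => F.
  apply: (@le_trans _ _ (\sum_(l <- F) a * weight t k l * rnorm g)).
    apply: ler_sum => l _; apply: (le_trans (le_opnorm _ _)).
    by rewrite ler_pM ?opnorm_ge0 ?rnorm_ge0 ?dA// ell2_coord_le.
  rewrite -mulr_suml -mulr_sumr ler_wpM2r ?rnorm_ge0//.
  by rewrite ler_wpM2l// wW.
pose T0 (g : L) k := projT1 (cid (ex g k)).
have T0P (g : L) k : has_sum (fun l => A k l (g l)) (T0 g k) := projT2 (cid (ex g k)).
have T0M (g : L) F : \sum_(k <- F) rnorm (T0 g k) ^+ 2 <= (a * W * rnorm g) ^+ 2.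
  have exc k : exists c, real_sum (fun l => weight t k l * rnorm (g l) ^+ 2) c /\
      forall G : {fset X}, \sum_(l <- G) weight t k l * rnorm (g l) ^+ 2 <= c.
    apply: (@bounded_real_sum _ _ _ (W * rnorm g ^+ 2)) => [l|G].
      by rewrite mulr_ge0 ?weight_ge0 ?sqr_ge0.
    apply: (@le_trans _ _ (\sum_(l <- G) weight t k l * rnorm g ^+ 2)).
      apply: ler_sum => l _; rewrite ler_wpM2l ?weight_ge0//.
      by rewrite ler_pXn2r ?nnegrE ?rnorm_ge0// ell2_coord_le.
    by rewrite -mulr_suml ler_wpM2r ?sqr_ge0.
  pose c k := projT1 (cid (exc k)).
  have cS k := (projT2 (cid (exc k))).1 : real_sum _ (c k).
  have cG k := (projT2 (cid (exc k))).2 : forall G : {fset X}, _ <= c k.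
  have c0 k : 0 <= c k by have := cG k fset0; rewrite big_seq_fset0.
  have Tc k : rnorm (T0 g k) ^+ 2 <= a ^+ 2 * W * c k.
    have aWc : 0 <= a ^+ 2 * W * c k by rewrite !mulr_ge0 ?sqr_ge0// ltW.
    rewrite -[leRHS]sqr_sqrtr// ler_pXn2r ?nnegrE ?rnorm_ge0 ?sqrtr_ge0//.
    apply: (has_sum_rnorm_le (T0P g k)) => G.
    rewrite -(ler_pXn2r (ltn0Sn 1)) ?nnegrE ?rnorm_ge0 ?sqrtr_ge0// sqr_sqrtr//.
    apply: (@le_trans _ _ ((a * \sum_(l <- G) weight t k l * rnorm (g l)) ^+ 2)).
      rewrite ler_pXn2r ?nnegrE ?rnorm_ge0//; last first.
        by rewrite mulr_ge0// sumr_ge0// => l _; rewrite mulr_ge0 ?weight_ge0 ?rnorm_ge0.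
      apply: (le_trans (ler_rnorm_sum _ _ _)); rewrite mulr_sumr.
      apply: ler_sum => l _; apply: (le_trans (le_opnorm _ _)).
      by rewrite mulrA ler_wpM2r ?rnorm_ge0.
    rewrite exprMn -mulrA ler_wpM2l ?sqr_ge0//.
    apply: (le_trans (weighted_cauchy_schwarz _ W0 (weight_ge0 t k) (wW k G))).
    by rewrite ler_wpM2l ?(ltW W0).
  apply: (@le_trans _ _ (\sum_(k <- F) a ^+ 2 * W * c k)).
    by apply: ler_sum => k _; exact: Tc.
  rewrite -mulr_sumr.
  have cW : \sum_(k <- F) c k <= W * rnorm g ^+ 2.
    apply: (real_sum_le (real_sum_big F cS)) => G.
    apply: (@le_trans _ _ (\sum_(l <- G) W * rnorm (g l) ^+ 2)).
      apply: ler_sum => l _; rewrite -mulr_suml ler_wpM2r ?sqr_ge0//.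
      by under eq_bigr do rewrite weightC; exact: wW.
    by rewrite -mulr_sumr ler_wpM2l ?(ltW W0)// ell2_sum_le.
  rewrite (_ : (a * W * rnorm g) ^+ 2 = a ^+ 2 * W * (W * rnorm g ^+ 2)); last by ring.
  by rewrite ler_wpM2l// mulr_ge0 ?sqr_ge0// ltW.
have exT (g : L) := ell2_of (mulr_ge0 (mulr_ge0 a0 (ltW W0)) (rnorm_ge0 g)) (T0M g).
pose T (g : L) := projT1 (cid (exT g)).
have [TE TM] : (forall g k, T g k = T0 g k) /\
    (forall g, rnorm (T g) <= a * W * rnorm g).
  by split=> g; [exact: (projT2 (cid (exT g))).1|exact: (projT2 (cid (exT g))).2].
have bT : T \in @bounded_linear R L L.
  apply/bounded_linearP; split; last by exists (a * W).
  move=> c g h; apply: ell2P => k; rewrite ell2D ell2Z !TE.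
  apply: (has_sum_unique (T0P (c *: g + h) k)).
  have := has_sumD (@has_sumZ _ _ _ c _ _ (T0P g k)) (T0P h k); apply: has_sum_eq => l.
  by rewrite ell2D ell2Z bopD bopZ.
exists (Bop bT); split=> [g k|]; first by have := T0P g k; rewrite -TE.
by apply: opnorm_le_bound => //; rewrite mulr_ge0// ltW.
Qed.

(** Inside the sum over n, nu_s(k - l) <= 2^s (nu_s(k - n) + nu_s(n - l)): in each of
    the two terms the decay of order s serves for one factor only, and the decay of
    order t of the other factor makes the sum converge. *)
Lemma decay_comp s t W a b p q (T S : bop L L) : 0 <= s -> summable_weight t W ->
  0 <= a -> 0 <= b -> 0 <= p -> 0 <= q ->
  decay s a (entry T) -> decay s b (entry S) ->
  decay t p (entry T) -> decay t q (entry S) ->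
  decay s (2 `^ s * W * (a * q + p * b)) (entry (bop_comp T S)).
Proof.
move=> s0 [W0 wW] a0 b0 p0 q0 aT bS pT qS k l.
have c0 : 0 <= 2 `^ s * W * (a * q + p * b).
  by rewrite !mulr_ge0 ?addr_ge0 ?mulr_ge0 ?powR_ge0// ltW.
apply: opnorm_le_bound => [|x]; first by rewrite mulr_ge0 ?weight_ge0.
apply: (has_sum_rnorm_le (@entry_represents _ _ _ T (S (delta l x)) k)) => F.
apply: (le_trans (ler_rnorm_sum _ _ _)).
have term n : rnorm (entry T k n (S (delta l x) n)) <=
    2 `^ s * (a * q * weight t n l + p * b * weight t k n) * weight s k l * rnorm x.
  apply: (@le_trans _ _ (opnorm (entry T k n) * opnorm (entry S n l) * rnorm x)).
    apply: (le_trans (le_opnorm _ _)); rewrite -mulrA ler_wpM2l ?opnorm_ge0//.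
    exact: (le_opnorm (entry S n l)).
  rewrite ler_wpM2r ?rnorm_ge0//.
  rewrite ler_pdivlMr ?nu_gt0//.
  apply: (@le_trans _ _ (opnorm (entry T k n) * opnorm (entry S n l) * (2 `^ s *
      (nu s (val k - val n) + nu s (val n - val l))))).
    rewrite ler_wpM2l ?mulr_ge0 ?opnorm_ge0//.
    by rewrite -[val k - val l](subrKA (val n)) nuD_le.
  have nus0 (y : 'rV[R]_d) : 0 <= nu s y by exact: powR_ge0.
  apply: product_split => //.
  - exact: opnorm_ge0.
  - exact: opnorm_ge0.
  - by rewrite -ler_pdivlMr ?nu_gt0//; exact: aT.
  - by rewrite -ler_pdivlMr ?nu_gt0//; exact: bS.
apply: (le_trans (ler_sum _ (fun n _ => term n))).
rewrite -mulr_suml ler_wpM2r ?rnorm_ge0// -mulr_suml ler_wpM2r ?weight_ge0//.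
apply: sum_combination_le; [exact: powR_ge0|exact: mulr_ge0|exact: mulr_ge0| |exact: wW].
by under eq_bigr do rewrite weightC; exact: wW.
Qed.

(** Write |A k l| = |A k l|^th |A k l|^(1 - th), bounding the first factor by the decay
    and the second one by o. *)
Lemma decay_interpolate s th a o A : 0 < th -> th < 1 -> 0 <= a -> 0 <= o ->
  decay s a A -> (forall k l, opnorm (A k l) <= o) ->
  decay (s * th) (a `^ th * o `^ (1 - th)) A.
Proof.
move=> th0 th1 a0 o0 aA oA k l; set u := opnorm (A k l).
have u0 : 0 <= u := opnorm_ge0 _.
have uE : u = u `^ th * u `^ (1 - th).
  by rewrite -powRD ?subrKC ?powRr1// oner_eq0.
rewrite uE mulrAC ler_pM ?powR_ge0//; last first.
  by apply: ge0_ler_powR; rewrite ?nnegrE ?subr_ge0 ?(ltW th1)//; exact: oA.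
apply: (@le_trans _ _ ((a * weight s k l) `^ th)).
  apply: ge0_ler_powR; rewrite ?nnegrE ?(ltW th0) ?mulr_ge0 ?weight_ge0//; exact: aA.
rewrite powRM ?weight_ge0// /weight ler_wpM2l ?powR_ge0//.
by rewrite /nu -powRN -powRrM -powRN mulNr.
Qed.

End off_diagonal_decay.

(** * The Jaffard class as an algebra of operators *)

Lemma sup_nneg {R : realType} (S : set R) : (forall x, S x -> 0 <= x) -> 0 <= sup S.
Proof.
move=> S0; have [supS|/sup_out ->//] := pselect (has_sup S).
have [x Sx] := supS.1; apply: (le_trans (S0 x Sx)).
by apply: sup_upper_bound.
Qed.

Section jaffard_algebra.
Context {R : realType} {d : nat} {X : set 'rV[R]_d} {H : completeNormedModType R[i]}.
Variable s : R.
Hypothesis X_sep : relatively_separated X.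
Hypothesis s_gt_d : d%:R < s.
Local Notation L := (ell2 X H).
Local Notation J := (jaffard X H s).
Implicit Types (A B : opmx X H) (k l : X).
Local Notation nJ := (@jaffard_norm R d X H s).

Let s_gt0 : 0 < s. Proof. exact: le_lt_trans s_gt_d. Qed.
Let s_ge0 : 0 <= s. Proof. exact: ltW. Qed.

Lemma jaffard_intro A a : 0 <= a -> decay s a A -> J A /\ nJ A <= a.
Proof.
move=> a0 dA; have ub x : jaffard_weights s A x -> x <= a.
  move=> [[k l] _ <-] /=; rewrite -ler_pdivlMr ?nu_gt0//; exact: dA.
split; first by exists a.
have [[x Sx]|/nonemptyPn S0] := pselect (jaffard_weights s A !=set0).
  by apply: ge_sup; [exists x|].
by rewrite /jaffard_norm S0 sup0.
Qed.

Lemma jaffard_decay A : J A -> decay s (nJ A) A.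
Proof.
move=> JA k l; rewrite ler_pdivlMr ?nu_gt0//.
by apply: ub_le_sup => //; exists (k, l).
Qed.

Lemma jaffard_norm_ge0 A : 0 <= nJ A.
Proof.
apply: sup_nneg => _ [[k l] _ <-]; rewrite mulr_ge0 ?rnorm_ge0//; exact: powR_ge0.
Qed.

Lemma jaffard_norm0_eq0 A : J A -> nJ A = 0 -> A = 0.
Proof.
move=> JA A0; apply/funext => k; apply/funext => l; apply/rnorm0_eq0/eqP.
by rewrite eq_le rnorm_ge0 andbT; have := jaffard_decay JA k l; rewrite A0 mul0r.
Qed.

Lemma opnorm0 (V W : normedModType R[i]) : opnorm (0 : bop V W) = 0.
Proof. exact: (@rnorm0 _ (bop V W)). Qed.

Lemma jaffard_norm0 : J 0 /\ nJ 0 <= 0.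
Proof.
apply: jaffard_intro => // k l.
by rewrite mul0r [(0 : opmx X H) k l](_ : _ = 0)// opnorm0.
Qed.

Lemma jaffard0 : J 0. Proof. exact: jaffard_norm0.1. Qed.

Lemma jaffard_norm_lin (c : R[i]) A B : J A -> J B ->
  J (c *: A + B) /\ nJ (c *: A + B) <= complex.Re `|c| * nJ A + nJ B.
Proof.
move=> JA JB; apply: jaffard_intro.
  by rewrite addr_ge0 ?mulr_ge0 ?Re_norm_ge0 ?jaffard_norm_ge0.
move=> k l; have -> : (c *: A + B) k l = c *: A k l + B k l by [].
apply: (le_trans (@ler_rnormD _ (bop H H) _ _)); rewrite rnormZ mulrDl -mulrA.
by rewrite lerD// ?ler_wpM2l ?Re_norm_ge0//; exact: jaffard_decay.
Qed.

Lemma jaffard_lin (c : R[i]) A B : J A -> J B -> J (c *: A + B).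
Proof. by move=> JA JB; have [] := jaffard_norm_lin c JA JB. Qed.

Lemma jaffardZ (c : R[i]) A : J A -> J (c *: A).
Proof. by move=> JA; have := jaffard_lin c JA jaffard0; rewrite addr0. Qed.

Lemma jaffardB A B : J A -> J B -> J (A - B).
Proof. by move=> JA JB; have := jaffard_lin (-1) JB JA; rewrite scaleN1r addrC. Qed.

Lemma jaffard_normD A B : J A -> J B -> nJ (A + B) <= nJ A + nJ B.
Proof.
move=> JA JB; have [_] := jaffard_norm_lin 1 JA JB.
by rewrite scale1r normr1 mul1r.
Qed.

Lemma jaffard_normZ_le (c : R[i]) A : J A -> nJ (c *: A) <= complex.Re `|c| * nJ A.
Proof.
move=> JA; have [_] := jaffard_norm_lin c JA jaffard0; rewrite addr0 => /le_trans; apply.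
by have := jaffard_norm0.2; lra.
Qed.

Lemma jaffard_represents A : J A -> exists T : bop L L, represents A T.
Proof.
move=> JA; have [W sW] := ex_summable_weight X_sep s_gt_d.
have [T [AT _]] := decay_represents sW (jaffard_norm_ge0 A) (jaffard_decay JA).
by exists T.
Qed.

Definition op A : bop L L := xget 0 [set T : bop L L | represents A T].

Lemma op_represents A : (exists T, represents A T) -> represents A (op A).
Proof. by move=> AT; exact: (@xgetPex _ _ [set T : bop L L | represents A T]). Qed.

Lemma opP A : J A -> represents A (op A).
Proof. by move=> JA; exact/op_represents/jaffard_represents. Qed.

Lemma entry_op A : J A -> entry (op A) = A.
Proof. by move=> JA; exact: represents_entry (opP JA). Qed.

Lemma op_unique A T : represents A T -> op A = T.
Proof.
by move=> AT; exact: (represents_unique (op_represents (ex_intro _ T AT)) AT).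
Qed.

Lemma op_entry T : op (entry T) = T.
Proof. exact/op_unique/entry_represents. Qed.

Lemma op_inj A B : J A -> J B -> op A = op B -> A = B.
Proof. by move=> JA JB AB; rewrite -(entry_op JA) AB entry_op. Qed.

Lemma opmx_mulE A B : J A -> J B -> opmx_mul A B = entry (bop_comp (op A) (op B)).
Proof. by move=> JA JB; rewrite -opmx_mul_entry !entry_op. Qed.

Lemma op_mul A B g : J A -> J B -> op (opmx_mul A B) g = op A (op B g).
Proof. by move=> JA JB; rewrite opmx_mulE// op_entry. Qed.

Lemma op_lin (c : R[i]) A B g : J A -> J B -> op (c *: A + B) g = c *: op A g + op B g.
Proof.
move=> JA JB; suff -> : op (c *: A + B) = c *: op A + op B by [].
apply: op_unique => h k.
rewrite bopDE bopZE ell2D ell2Z.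
have -> : (fun l => (c *: A + B) k l (h l)) = fun l => c *: A k l (h l) + B k l (h l).
  by apply/funext => l.
exact: (has_sumD (@has_sumZ _ _ _ c _ _ (@opP A JA h k)) (@opP B JB h k)).
Qed.

Lemma op0 g : op 0 g = 0.
Proof.
have := op_lin (-1) g jaffard0 jaffard0.
by rewrite scaler0 addr0 scaleN1r addNr.
Qed.

Lemma opZ (c : R[i]) A g : J A -> op (c *: A) g = c *: op A g.
Proof. by move=> JA; have := op_lin c g JA jaffard0; rewrite addr0 op0 addr0. Qed.

Lemma entry_id : entry (bop_id : bop L L) = opmx_one X H.
Proof.
apply/funext => k; apply/funext => l; apply: eq_bop => x.
by rewrite /opmx_one [LHS]deltaE; case: eqP.
Qed.

Lemma op_one g : op (opmx_one X H) g = g.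
Proof. by rewrite -entry_id op_entry. Qed.

Lemma jaffard_one : J (opmx_one X H).
Proof.
apply: (proj1 (@jaffard_intro _ 1 ler01 _)) => k l; rewrite mul1r /opmx_one.
case: eqP => [<-|_]; last by rewrite opnorm0 weight_ge0.
rewrite /weight subrr nu0 invr1.
by apply: opnorm_le_bound => // x; rewrite mul1r.
Qed.

Lemma jaffard_mul_bound : exists2 C, 0 < C & forall A B, J A -> J B ->
  J (opmx_mul A B) /\ nJ (opmx_mul A B) <= C * nJ A * nJ B.
Proof.
have [W sW] := ex_summable_weight X_sep s_gt_d.
exists (2 `^ s * W * 2) => [|A B JA JB].
  by rewrite mulr_gt0// mulr_gt0 ?powR_gt0// sW.1.
rewrite opmx_mulE//.
have a0 := jaffard_norm_ge0 A; have b0 := jaffard_norm_ge0 B.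
have dA : decay s (nJ A) (entry (op A)) by rewrite entry_op//; exact: jaffard_decay.
have dB : decay s (nJ B) (entry (op B)) by rewrite entry_op//; exact: jaffard_decay.
apply: jaffard_intro.
  by rewrite !mulr_ge0 ?powR_ge0//; exact: ltW sW.1.
rewrite (_ : _ * nJ B = 2 `^ s * W * (nJ A * nJ B + nJ A * nJ B)); last by ring.
exact: (decay_comp s_ge0 sW).
Qed.

Lemma jaffard_mul A B : J A -> J B -> J (opmx_mul A B).
Proof. by move=> JA JB; have [C _ CP] := jaffard_mul_bound; have [] := CP A B JA JB. Qed.

(** All entries are bounded by the operator norm. Interpolating this bound with the
    decay of order s gives a decay of order s th > d, which [decay_comp] accepts for
    one of the two factors; this trades a power of the Jaffard norm for the same power
    of the operator norm. *)
Lemma jaffard_sqr_bound : exists2 th, 0 < th < 1 & exists2 K, 0 < K &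
  forall A a o, J A -> nJ A <= a -> opnorm (op A) <= o -> 0 <= o ->
  nJ (opmx_mul A A) <= K * (a * (a `^ th * o `^ (1 - th))).
Proof.
(* The midpoint of d / s and 1, so that s th > d while th < 1. *)
pose th := (d%:R / s + 1) / 2.
have ds0 : 0 <= d%:R / s by rewrite divr_ge0.
have ds1 : d%:R / s < 1 by rewrite ltr_pdivrMr// mul1r.
have th0 : 0 < th by rewrite /th; lra.
have th1 : th < 1 by rewrite /th; lra.
have dth : d%:R < s * th.
  rewrite mulrC -ltr_pdivrMr//; rewrite /th; lra.
exists th; first by rewrite th0.
have [W sW] := ex_summable_weight X_sep dth.
exists (2 `^ s * W * 2) => [|A a o JA Aa Ao o0].
  by rewrite mulr_gt0// mulr_gt0 ?powR_gt0// sW.1.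
have a0 : 0 <= a := le_trans (jaffard_norm_ge0 A) Aa.
set p := a `^ th * o `^ (1 - th).
have p0 : 0 <= p by rewrite mulr_ge0 ?powR_ge0.
have dA : decay s a (entry (op A)).
  by rewrite entry_op//; apply: decay_weaken Aa _; exact: jaffard_decay.
have dt : decay (s * th) p (entry (op A)).
  apply: decay_interpolate => // k l.
  by rewrite (le_trans (opnorm_entry _ _ _)).
rewrite opmx_mulE//.
have := decay_comp s_ge0 sW a0 a0 p0 p0 dA dA dt dt.
rewrite (_ : 2 `^ s * W * (a * p + p * a) = 2 `^ s * W * 2 * (a * p)); last by ring.
move=> /jaffard_intro[]//.
by rewrite !mulr_ge0 ?powR_ge0//; exact: ltW sW.1.
Qed.

(** Entries converge because the weights are at least 1, and the bound on the
    differences survives the entrywise limit. *)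
Lemma jaffard_complete (u : nat -> opmx X H) : (forall n, J (u n)) ->
  (forall e : R, 0 < e -> exists N, forall m n, (N <= m)%N -> (N <= n)%N ->
    nJ (u m - u n) < e) ->
  exists2 A, J A & forall e : R, 0 < e -> exists N, forall n, (N <= n)%N ->
    nJ (u n - A) <= e.
Proof.
move=> Ju uC.
have weight_le1 k l : weight s k l <= 1.
  by rewrite invf_le1 ?nu_gt0// nu_ge1.
have ex k l : exists T : bop H H, forall e : R, 0 < e -> exists N, forall n, (N <= n)%N ->
    opnorm (u n k l - T) <= e.
  apply: bop_cauchy_cvg => e e0; have [N NP] := uC e e0; exists N => m n Nm Nn.
  apply: le_lt_trans (NP m n Nm Nn).
  apply: (le_trans (jaffard_decay (jaffardB (Ju m) (Ju n)) k l)).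
  by rewrite ler_piMr ?jaffard_norm_ge0.
pose A : opmx X H := fun k l => projT1 (cid (ex k l)).
have AP k l : forall e : R, 0 < e -> exists N, forall n, (N <= n)%N ->
  opnorm (u n k l - A k l) <= e := projT2 (cid (ex k l)).
have uA (e : R) : 0 < e -> exists N, forall n, (N <= n)%N -> decay s e (u n - A).
  move=> e0; have [N NP] := uC e e0; exists N => n Nn k l.
  apply/ler_addgt0Pr => r r0; have [N' N'P] := AP k l r r0.
  pose m := maxn N N'.
  have -> : (u n - A) k l = (u n - u m) k l + (u m k l - A k l).
    have -> : (u n - A) k l = u n k l - A k l by [].
    have -> : (u n - u m) k l = u n k l - u m k l by [].
    by rewrite addrA subrK.
  apply: (le_trans (@ler_rnormD _ (bop H H) _ _)); apply: lerD; last first.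
    exact/N'P/leq_maxr.
  apply: (le_trans (jaffard_decay (jaffardB (Ju n) (Ju m)) k l)).
  by rewrite ler_wpM2r ?weight_ge0// ltW// NP// leq_maxl.
exists A.
  have [N NP] := uA 1 ltr01; have [JD _] := jaffard_intro ler01 (NP N (leqnn N)).
  have -> : A = u N - (u N - A) by rewrite opprB addrC subrK.
  exact: jaffardB.
move=> e e0; have [N NP] := uA e e0; exists N => n Nn.
by have [] := jaffard_intro (ltW e0) (NP n Nn).
Qed.

Section star.
Variable dot : {dot H for Num.conj}.
Hypothesis dot_norm : forall x : H, `|x| ^+ 2 = dot x x.
Local Notation star := (opmx_star dot).

Lemma jaffard_star A : J A -> J (star A).
Proof.
move=> JA; apply: (proj1 (@jaffard_intro _ (nJ A) (jaffard_norm_ge0 A) _)) => k l.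
by rewrite (le_trans (opnorm_adjoint dot_norm _))// weightC; exact: jaffard_decay.
Qed.

Lemma starK A : star (star A) = A.
Proof. by apply/funext => k; apply/funext => l; exact: (adjointK dot_norm). Qed.

Lemma star_lin (c : R[i]) A B : star (c *: A + B) = c^* *: star A + star B.
Proof.
apply/funext => k; apply/funext => l; rewrite /opmx_star.
exact: (adjoint_linear dot_norm).
Qed.

Lemma rip_star A g h : J A -> rip (op A g) h = rip g (op (star A) h).
Proof.
move=> JA; apply: (rip_adjoint dot_norm (opP JA) (opP (jaffard_star JA))) => k l.
exact: (adjointP dot_norm).
Qed.


(** Entries are recovered by pairing with the families [delta], so an adjoint on [ell2]
    determines the matrix of adjoints. *)
Lemma op_star_adjoint A T : J A -> J (entry T) ->
  (forall g h, rip (op A g) h = rip g (T h)) -> star A = entry T.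
Proof.
move=> JA JT AT; apply/funext => k; apply/funext => l; apply: (adjointE dot_norm) => x y.
have := AT (delta k x) (delta l y); rewrite (rip_delta dot_norm) (ripC (delta k x)).
rewrite (rip_delta dot_norm) (rdotC dot _ x) => <-.
by rewrite -[in LHS](entry_op JA).
Qed.

Lemma star_mul A B : J A -> J B -> star (opmx_mul A B) = opmx_mul (star B) (star A).
Proof.
move=> JA JB; have [JsA JsB] := (jaffard_star JA, jaffard_star JB).
rewrite (opmx_mulE JsB JsA); apply: op_star_adjoint; first exact: jaffard_mul.
  by rewrite -opmx_mulE//; exact: jaffard_mul.
by move=> g h; rewrite op_mul// !rip_star.
Qed.

Lemma star_one : star (opmx_one X H) = opmx_one X H.
Proof.
rewrite -[RHS]entry_id; apply: op_star_adjoint => [||g h]; first exact: jaffard_one.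
  by rewrite entry_id; exact: jaffard_one.
by rewrite op_one.
Qed.

End star.
End jaffard_algebra.

(** * Inverses in an involutive Banach algebra *)

Section banach_inverse.
Context {R : realType} {M : lmodType R[i]} (J : set M).
Variables (mul : M -> M -> M) (one : M) (star : M -> M) (nrm : M -> R).
Hypothesis iba : involutive_banach_algebra J mul one star nrm.
Implicit Types A B E : M.

Definition invertible A := exists2 B, J B & mul A B = one /\ mul B A = one.

Lemma spectrum_not_invertible A z : spectrum J mul one A z -> ~ invertible (A - z *: one).
Proof. by []. Qed.

Let J0 := iba_zero iba.
Let J1 := iba_one iba.
Let JM := iba_mul iba.

Lemma ibaD A B : J A -> J B -> J (A + B).
Proof. by move=> JA JB; have := iba_lin iba 1 JA JB; rewrite scale1r. Qed.

Lemma ibaZ (a : R[i]) A : J A -> J (a *: A).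
Proof. by move=> JA; have := iba_lin iba a JA J0; rewrite addr0. Qed.

Lemma ibaB A B : J A -> J B -> J (A - B).
Proof. by move=> JA JB; have := iba_lin iba (-1) JB JA; rewrite scaleN1r addrC. Qed.

Lemma iba_mulBl A B C : J A -> J B -> J C -> mul (A - B) C = mul A C - mul B C.
Proof.
by move=> JA JB JC; have := iba_mulDl iba (-1) JB JA JC; rewrite !scaleN1r !(addrC (- _)).
Qed.

Lemma iba_mulBr A B C : J A -> J B -> J C -> mul C (A - B) = mul C A - mul C B.
Proof.
by move=> JA JB JC; have := iba_mulDr iba (-1) JB JA JC; rewrite !scaleN1r !(addrC (- _)).
Qed.

Lemma iba_mulDl1 A B C : J A -> J B -> J C -> mul (A + B) C = mul A C + mul B C.
Proof. by move=> JA JB JC; have := iba_mulDl iba 1 JA JB JC; rewrite !scale1r. Qed.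

Lemma iba_mulDr1 A B C : J A -> J B -> J C -> mul C (A + B) = mul C A + mul C B.
Proof. by move=> JA JB JC; have := iba_mulDr iba 1 JA JB JC; rewrite !scale1r. Qed.

Lemma iba_mul0r A : J A -> mul A 0 = 0.
Proof. by move=> JA; have := iba_mulBr J0 J0 JA; rewrite !subrr. Qed.

Lemma iba_mul0l A : J A -> mul 0 A = 0.
Proof. by move=> JA; have := iba_mulBl J0 J0 JA; rewrite !subrr. Qed.

Lemma nrmN A : J A -> nrm (- A) = nrm A.
Proof. by move=> JA; rewrite -scaleN1r (iba_normZ iba)// normrN1 mul1r. Qed.

Lemma nrm0 : nrm 0 = 0.
Proof. by have := iba_normZ iba 0 J0; rewrite scale0r normr0 mul0r. Qed.

Lemma nrm_ge0 A : J A -> 0 <= nrm A.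
Proof.
move=> JA; have JN : J (- A) by rewrite -scaleN1r; exact: ibaZ.
by have := iba_normD iba JA JN; rewrite subrr nrm0 nrmN//; lra.
Qed.

Lemma nrm_le0 A : J A -> nrm A <= 0 -> A = 0.
Proof.
by move=> JA A0; apply: (iba_norm0 iba) => //; apply/eqP; rewrite eq_le A0 nrm_ge0.
Qed.

Lemma left_right_inverse A B C : J A -> J B -> J C ->
  mul B A = one -> mul A C = one -> invertible A.
Proof.
move=> JA JB JC BA AC; exists B => //; split=> //.
have -> // : B = C.
by rewrite -(iba_mul1 iba JB).2 -AC (iba_mulA iba)// BA (iba_mul1 iba JC).1.
Qed.

(** The sum of the n first powers of E. *)
Fixpoint neumann E n := if n is m.+1 then one + mul E (neumann E m) else 0.

Lemma neumann_J E n : J E -> J (neumann E n).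
Proof. by move=> JE; elim: n => //= n IH; apply: ibaD => //; exact: JM. Qed.

Lemma neumann_comm E n : J E -> mul E (neumann E n) = mul (neumann E n) E.
Proof.
move=> JE; elim: n => [|n IH] /=; first by rewrite iba_mul0l ?iba_mul0r.
have Jn := neumann_J n JE; have JEn := JM JE Jn.
rewrite iba_mulDr1// iba_mulDl1// (iba_mul1 iba JE).1 (iba_mul1 iba JE).2.
by rewrite {1}IH (iba_mulA iba).
Qed.

(** The partial sums S_n satisfy S_(n+1) = 1 + E S_n, so that consecutive differences
    are multiplied by E at each step; the limit B satisfies B = 1 + E B and commutes
    with E. *)
Lemma one_sub_invertible E : J E -> nrm E < 1 -> invertible (one - E).
Proof.
move=> JE E1; set r := nrm E; have r0 : 0 <= r by exact: nrm_ge0.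
pose S n := neumann E n; have JS n : J (S n) by exact: neumann_J.
have c0 : 0 <= nrm one by exact: nrm_ge0.
have step n : nrm (S n.+1 - S n) <= r ^+ n * nrm one.
  elim: n => [|n IH].
    by rewrite /S /= expr0 mul1r subr0 iba_mul0r// addr0.
  have -> : S n.+2 - S n.+1 = mul E (S n.+1 - S n).
    by rewrite iba_mulBr// /S /= opprD addrACA subrr add0r.
  apply: (le_trans (iba_normM iba JE (ibaB (JS _) (JS _)))).
  by rewrite exprS -mulrA ler_wpM2l.
have r1 : 0 < 1 - r by rewrite subr_gt0.
have tail n k : nrm (S (n + k)%N - S n) <= (r ^+ n - r ^+ (n + k)) / (1 - r) * nrm one.
  elim: k => [|k IH]; first by rewrite addn0 !subrr nrm0 mul0r mul0r.
  have -> : S (n + k.+1)%N - S n = (S (n + k).+1 - S (n + k)%N) + (S (n + k)%N - S n).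
    by rewrite addnS addrA subrK.
  apply: (le_trans (iba_normD iba (ibaB (JS _) (JS _)) (ibaB (JS _) (JS _)))).
  apply: (le_trans (lerD (step _) IH)); rewrite addnS exprS.
  rewrite le_eqVlt; apply/orP; left; apply/eqP; field.
  by rewrite gt_eqF.
have small e : 0 < e -> exists N, forall n, (N <= n)%N -> r ^+ n * nrm one / (1 - r) < e.
  move=> e0; have /cvgrPdist_lt rn : r ^+ n @[n --> \oo] --> 0.
    by apply: cvg_expr; rewrite ger0_norm.
  have e' : 0 < e * (1 - r) / (nrm one + 1) by rewrite divr_gt0 ?mulr_gt0// ltr_wpDl.
  have [N _ NP] := rn _ e'; exists N => n Nn; have := NP n Nn.
  rewrite /= sub0r normrN ger0_norm ?exprn_ge0// => rne.
  rewrite ltr_pdivrMr//; move: rne; rewrite ltr_pdivlMr ?ltr_wpDl//; apply: le_lt_trans.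
  by rewrite ler_wpM2l ?exprn_ge0// lerDl.
have close n k : nrm (S (n + k)%N - S n) <= r ^+ n * nrm one / (1 - r).
  apply: (le_trans (tail n k)); rewrite mulrAC ler_wpM2r ?invr_ge0 ?(ltW r1)//.
  by rewrite ler_wpM2r// gerBl exprn_ge0.
have [|B JB SB] := iba_complete iba JS.
  move=> e e0; have [|N NP] := small (e / 2); first by rewrite divr_gt0.
  exists N => m n Nm Nn.
  have -> : S m - S n = (S m - S N) - (S n - S N) by rewrite opprB addrA subrK.
  have JmN := ibaB (JS m) (JS N); have JnN := ibaB (JS n) (JS N).
  have JnN' : J (- (S n - S N)) by rewrite -scaleN1r; exact: ibaZ.
  apply: (le_lt_trans (iba_normD iba JmN JnN')); rewrite nrmN//.
  have := close N (m - N)%N; have := close N (n - N)%N; rewrite !subnKC//.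
  have := NP N (leqnn N); lra.
have lim (e : R) : 0 < e -> exists n, nrm (S n - B) < e /\ nrm (S n.+1 - B) < e.
  move=> e0; move/cvgrPdist_lt: SB => /(_ e e0)[N _ NP]; exists N.
  have aux n : (N <= n)%N -> nrm (S n - B) < e.
    move=> Nn; have := NP n Nn; rewrite /= sub0r normrN ger0_norm//.
    exact/nrm_ge0/ibaB.
  by split; apply: aux.
have BE : B = one + mul E B.
  apply/eqP; rewrite -subr_eq0; apply/eqP/nrm_le0.
    by apply: ibaB => //; apply: ibaD => //; exact: JM.
  apply/ler_addgt0Pr => e e0; rewrite add0r.
  have [|n [Sn Sn1]] := lim (e / 2); first by rewrite divr_gt0.
  have -> : B - (one + mul E B) = mul E (S n - B) - (S n.+1 - B).
    have -> : S n.+1 = one + mul E (S n) by [].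
    rewrite iba_mulBr// [in RHS]opprB [RHS]addrCA.
    congr (_ + _); rewrite (addrC one (mul E (S n))) [in RHS]opprD addrACA subrr add0r.
    by rewrite -opprD addrC.
  have JD1 := ibaB (JS n) JB; have JD2 := ibaB (JS n.+1) JB.
  have JD3 : J (- (S n.+1 - B)) by rewrite -scaleN1r; exact: ibaZ.
  apply: (le_trans (iba_normD iba (JM JE JD1) JD3)); rewrite nrmN//.
  have : nrm (mul E (S n - B)) <= nrm (S n - B).
    apply: (le_trans (iba_normM iba JE JD1)).
    by rewrite ler_piMl ?nrm_ge0// ltW.
  lra.
have EB : mul E B = mul B E.
  apply/eqP; rewrite -subr_eq0; apply/eqP/nrm_le0.
    by apply: ibaB => //; exact: JM.
  apply/ler_addgt0Pr => e e0; rewrite add0r.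
  have [|n [Sn _]] := lim (e / 2); first by rewrite divr_gt0.
  have -> : mul E B - mul B E = mul (S n - B) E - mul E (S n - B).
    rewrite iba_mulBl// iba_mulBr// -(neumann_comm n JE) -/(S n).
    by rewrite [in RHS]opprB [RHS]addrC addrA subrK.
  have JD := ibaB (JS n) JB; have JED := JM JE JD; have JDE := JM JD JE.
  have JN : J (- mul E (S n - B)) by rewrite -scaleN1r; exact: ibaZ.
  apply: (le_trans (iba_normD iba JDE JN)); rewrite nrmN//.
  have n0 := nrm_ge0 JD.
  have : nrm (mul E (S n - B)) <= nrm (S n - B).
    by apply: (le_trans (iba_normM iba JE JD)); rewrite ler_piMl// ltW.
  have : nrm (mul (S n - B) E) <= nrm (S n - B).
    by apply: (le_trans (iba_normM iba JD JE)); rewrite ler_piMr// ltW.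
  lra.
exists B => //; rewrite iba_mulBl// iba_mulBr// (iba_mul1 iba JB).1 (iba_mul1 iba JB).2.
by rewrite -EB {1 3}BE addrK.
Qed.

(** 1 - A^2 = (1 - A) (1 + A) = (1 + A) (1 - A). *)
Lemma one_sub_sqr_invertible A : J A -> invertible (one - mul A A) -> invertible (one - A).
Proof.
move=> JA [B JB [AB BA]].
have JAA := JM JA JA; have J1A := ibaB J1 JA; have J1p := ibaD J1 JA.
have E1 : mul (one - A) (one + A) = one - mul A A.
  rewrite iba_mulBl// (iba_mul1 iba J1p).1 iba_mulDr1// (iba_mul1 iba JA).2.
  by rewrite opprD addrA addrK.
have E2 : mul (one + A) (one - A) = one - mul A A.
  rewrite iba_mulBr// (iba_mul1 iba J1p).2 iba_mulDl1// (iba_mul1 iba JA).1.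
  by rewrite opprD addrA addrK.
apply: (@left_right_inverse _ (mul B (one + A)) (mul (one + A) B)) => //; try exact: JM.
  by rewrite -(iba_mulA iba)// E2.
by rewrite (iba_mulA iba)// E1.
Qed.

Lemma iter_sqr_J A n : J A -> J (iter n (fun B => mul B B) A).
Proof. by move=> JA; elim: n => //= n IH; exact: JM. Qed.

Lemma iter_sqr_invertible A n : J A ->
  nrm (iter n (fun B => mul B B) A) < 1 -> invertible (one - A).
Proof.
move=> JA n1; have : invertible (one - iter n (fun B => mul B B) A).
  by apply: one_sub_invertible => //; exact: iter_sqr_J.
elim: n {n1} => // n IH /= /one_sub_sqr_invertible inv.
by apply/IH/inv/iter_sqr_J.
Qed.

End banach_inverse.

(** * Inverse-closedness and symmetry *)

(** As (q / 2)^n tends to 0, the term q^n D is eventually below half of - 2^n lam. *)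
Lemma dominated_exponent {R : realType} (lam q D c t : R) : lam < 0 -> 0 <= q < 2 ->
  exists n, 2 ^+ n * lam + q ^+ n * D + c < t.
Proof.
move=> lam0 /andP[q0 q2]; pose e := - lam / 2 / (`|D| + 1).
have D1 : 0 < `|D| + 1 by rewrite ltr_wpDl.
have e0 : 0 < e by rewrite /e divr_gt0//; lra.
have /cvgrPdist_lt/(_ e e0)[N _ NP] : (q / 2) ^+ n @[n --> \oo] --> 0.
  by apply: cvg_expr; rewrite ger0_norm ?divr_ge0// ltr_pdivrMr// mul1r.
pose N' := Num.bound (`|t - c| / (- lam / 2)); pose n := maxn N N'.
have := NP n (leq_maxl _ _).
rewrite /= sub0r normrN ger0_norm ?exprn_ge0 ?divr_ge0// expr_div_n.
rewrite ltr_pdivrMr ?exprn_gt0// => qn.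
have l2 : 0 < - lam / 2 by lra.
have tn : `|t - c| < 2 ^+ n * (- lam / 2).
  rewrite -ltr_pdivrMr//; apply: (lt_le_trans (archi_boundP _)).
    by rewrite divr_ge0// ltW.
  rewrite -natrX ler_nat; apply: (leq_trans (leq_maxr N _)).
  exact/ltnW/ltn_expl.
exists n.
have : q ^+ n * D <= 2 ^+ n * (- lam / 2).
  apply: (@le_trans _ _ (q ^+ n * (`|D| + 1))).
    by rewrite ler_wpM2l ?exprn_ge0// (le_trans (ler_norm _))// lerDl.
  apply: (le_trans (ler_wpM2r (ltW D1) (ltW qn))).
  by rewrite /e mulrAC divfK ?gt_eqF// mulrC.
have := ler_norm (- (t - c)); rewrite normrN; move: tn.
rewrite (_ : 2 ^+ n * (- lam / 2) = - (2 ^+ n * lam) / 2); last by ring.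
move: (2 ^+ n * lam) (q ^+ n * D) => x y; lra.
Qed.

(** In logarithmic form the recursion is
    x_(n+1) = k + (1 + th) x_n + (1 - th) 2^n lam with k = ln K. It is solved by
    x_n = 2^n lam + (1 + th)^n D - k / th, where the first term wins since 1 + th < 2. *)
Lemma superlinear_decay {R : realType} (f o : nat -> R) (th K lam e : R) :
  0 < th < 1 -> 0 < K -> lam < 0 -> 0 < e -> 0 <= f 0%N ->
  (forall n, o n <= expR (2 ^+ n * lam)) ->
  (forall n a b, f n <= a -> o n <= b -> 0 <= b ->
    f n.+1 <= K * (a * (a `^ th * b `^ (1 - th)))) ->
  exists n, f n < e.
Proof.
move=> /andP[th0 th1] K0 lam0 e0 f0 oE step.
pose k := ln K; pose D := ln (f 0%N + 1) - lam + k / th.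
have fE n : f n <= expR (2 ^+ n * lam + (1 + th) ^+ n * D - k / th).
  elim: n => [|n IH].
    rewrite !expr0 !mul1r (_ : _ - _ = ln (f 0%N + 1)); last by rewrite /D; ring.
    by rewrite lnK ?posrE ?ltr_wpDl// lerDl.
  apply: (le_trans (step n _ _ IH (oE n) (expR_ge0 _))).
  rewrite -[K](@lnK _ K) ?posrE// -/k -!expRM -!expRD ler_expR le_eqVlt.
  by apply/orP; left; apply/eqP; rewrite !exprS; field; rewrite gt_eqF.
have q : 0 <= 1 + th < 2 by lra.
have [n nP] := dominated_exponent D (- (k / th)) (ln e) lam0 q.
exists n; apply: (le_lt_trans (fE n)).
by rewrite -[ltRHS](@lnK _ e) ?posrE// ltr_expR.
Qed.

Section jaffard_banach_algebra.
Context {R : realType} {d : nat} {X : set 'rV[R]_d} {H : completeNormedModType R[i]}.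
Variable (dot : {dot H for Num.conj}).
Hypothesis dot_norm : forall x : H, `|x| ^+ 2 = dot x x.
Variable s : R.
Hypothesis X_sep : relatively_separated X.
Hypothesis s_gt_d : d%:R < s.
Local Notation L := (ell2 X H).
Local Notation J := (jaffard X H s).
Local Notation nJ := (@jaffard_norm R d X H s).
Local Notation nop := (@jaffard_opnorm R d X H s).
Local Notation one := (opmx_one X H).
Local Notation star := (opmx_star dot).
Implicit Types A B C : opmx X H.

Let JM {A B} := @jaffard_mul R d X H s X_sep s_gt_d A B.
Let J1 := @jaffard_one R d X H s.
Let J0 := @jaffard0 R d X H s.
Let Jlin := @jaffard_lin R d X H s.
Let opM {A B} (JA : J A) (JB : J B) g := op_mul X_sep s_gt_d g JA JB.
Let opL (c : R[i]) {A B} (JA : J A) (JB : J B) g := op_lin X_sep s_gt_d c g JA JB.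

Let opS (c : R[i]) {A} (JA : J A) g := opZ X_sep s_gt_d c g JA.

Lemma jaffard_ext A B : J A -> J B -> (forall g, op A g = op B g) -> A = B.
Proof.
by move=> JA JB AB; apply: (op_inj X_sep s_gt_d JA JB); exact: eq_bop.
Qed.

Lemma opmx_mul1 A : J A -> opmx_mul one A = A /\ opmx_mul A one = A.
Proof.
move=> JA; split.
  by apply: (jaffard_ext (JM J1 JA) JA) => g; rewrite (opM J1 JA) op_one.
by apply: (jaffard_ext (JM JA J1) JA) => g; rewrite (opM JA J1) op_one.
Qed.

Lemma opmx_mulA A B C : J A -> J B -> J C ->
  opmx_mul A (opmx_mul B C) = opmx_mul (opmx_mul A B) C.
Proof.
move=> JA JB JC; have JAB := JM JA JB; have JBC := JM JB JC.
apply: (jaffard_ext (JM JA JBC) (JM JAB JC)) => g.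
by rewrite (opM JA JBC) (opM JB JC) (opM JAB JC) (opM JA JB).
Qed.

Lemma opmx_mulDl (c : R[i]) A B C : J A -> J B -> J C ->
  opmx_mul (c *: A + B) C = c *: opmx_mul A C + opmx_mul B C.
Proof.
move=> JA JB JC; have JAB := Jlin c JA JB; have JAC := JM JA JC; have JBC := JM JB JC.
apply: (jaffard_ext (JM JAB JC) (Jlin c JAC JBC)) => g.
by rewrite (opM JAB JC) (opL c JA JB) (opL c JAC JBC) (opM JA JC) (opM JB JC).
Qed.

Lemma opmx_mulDr (c : R[i]) A B C : J A -> J B -> J C ->
  opmx_mul C (c *: A + B) = c *: opmx_mul C A + opmx_mul C B.
Proof.
move=> JA JB JC; have JAB := Jlin c JA JB; have JAC := JM JC JA; have JBC := JM JC JB.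
apply: (jaffard_ext (JM JC JAB) (Jlin c JAC JBC)) => g.
rewrite (opM JC JAB) (opL c JA JB) (opL c JAC JBC) (opM JC JA) (opM JC JB).
by rewrite bopD bopZ.
Qed.

Lemma opmx_mulZl (c : R[i]) A B : J A -> J B -> opmx_mul (c *: A) B = c *: opmx_mul A B.
Proof.
move=> JA JB; have JcA := jaffardZ c JA; have JAB := JM JA JB.
apply: (jaffard_ext (JM JcA JB) (jaffardZ c JAB)) => g; rewrite (opM JcA JB).
by rewrite (opS c JA) (opS c JAB) (opM JA JB).
Qed.

Lemma opmx_mulZr (c : R[i]) A B : J A -> J B -> opmx_mul B (c *: A) = c *: opmx_mul B A.
Proof.
move=> JA JB; have JcA := jaffardZ c JA; have JBA := JM JB JA.
apply: (jaffard_ext (JM JB JcA) (jaffardZ c JBA)) => g; rewrite (opM JB JcA).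
by rewrite (opS c JA) (opS c JBA) (opM JB JA) bopZ.
Qed.

Lemma nop_ge0 A : 0 <= nop A.
Proof. by apply: sup_nneg => _ [B _ <-]; exact: jaffard_norm_ge0. Qed.

Lemma nop_le A c : 0 <= c ->
  (forall B, J B -> nJ (opmx_mul A B) <= c * nJ B) -> nop A <= c.
Proof.
move=> c0 Ac; set S := [set jaffard_norm s (opmx_mul A B) | B in [set B | J B /\ nJ B = 1]].
have [[x Sx]|/nonemptyPn S0] := pselect (S !=set0).
  apply: ge_sup; first by exists x.
  by move=> _ [B [JB B1] <-]; have := Ac B JB; rewrite B1 mulr1.
by rewrite /jaffard_opnorm -/S S0 sup0.
Qed.

(** For B <> 0 rescale B to Jaffard norm 1. *)
Lemma nop_mul A B : J A -> J B -> nJ (opmx_mul A B) <= nop A * nJ B.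
Proof.
move=> JA JB; have [C C0 CP] := @jaffard_mul_bound R d X H s X_sep s_gt_d.
have [B0|B0] := eqVneq (nJ B) 0.
  have [_] := CP A B JA JB; rewrite B0 !mulr0 => /le_trans; apply.
  by rewrite lexx.
have Bp : 0 < nJ B by rewrite lt0r B0 jaffard_norm_ge0.
pose c := ((nJ B)^-1)%:C : R[i].
have cE : complex.Re `|c| = (nJ B)^-1.
  by rewrite ger0_norm// ler0c invr_ge0 ltW.
have JcB : J (c *: B) by exact: jaffardZ.
have BE : B = (nJ B)%:C *: (c *: B).
  by rewrite scalerA -real_complexM divff// scale1r.
have cB1 : nJ (c *: B) = 1.
  apply/eqP; rewrite eq_le; apply/andP; split.
    by have := jaffard_normZ_le c JB; rewrite cE mulVf.
  have := jaffard_normZ_le ((nJ B)%:C) JcB; rewrite -BE ger0_norm ?ler0c ?(ltW Bp)//=.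
  by rewrite ler_pMr.
have ub : nJ (opmx_mul A (c *: B)) <= nop A.
  apply: ub_le_sup; last by exists (c *: B).
  by exists (C * nJ A) => _ [D [JD D1] <-]; have [_] := CP A D JA JD; rewrite D1 mulr1.
rewrite {1}BE (opmx_mulZr _ JcB JA).
apply: (le_trans (jaffard_normZ_le _ (JM JA JcB))).
by rewrite ger0_norm ?ler0c ?(ltW Bp)//= mulrC ler_wpM2r ?(ltW Bp).
Qed.

Lemma jaffard_norm_le_nop A : J A -> nJ A <= nop A * nJ one.
Proof. by move=> JA; have := nop_mul JA J1; rewrite (opmx_mul1 JA).2. Qed.

Lemma nopZ_le (c : R[i]) A : J A -> nop (c *: A) <= complex.Re `|c| * nop A.
Proof.
move=> JA; apply: nop_le => [|B JB]; first by rewrite mulr_ge0 ?Re_norm_ge0 ?nop_ge0.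
rewrite (opmx_mulZl c JA JB).
apply: (le_trans (jaffard_normZ_le _ (JM JA JB))).
by rewrite -mulrA ler_wpM2l ?Re_norm_ge0// nop_mul.
Qed.

Lemma jaffard_iba : involutive_banach_algebra J (@opmx_mul R X H) one star nop.
Proof.
split.
- exact: jaffard0.
- by move=> c A B; exact: Jlin.
- by move=> A B; exact: JM.
- exact: J1.
- by move=> A; exact: jaffard_star.
- exact: opmx_mulA.
- exact: opmx_mul1.
- exact: opmx_mulDl.
- exact: opmx_mulDr.
- by move=> A _; exact: starK.
- by move=> c A B _ _; exact: star_lin.
- by move=> A B; exact: (star_mul X_sep s_gt_d dot_norm).
- move=> A JA A0; apply: (jaffard_norm0_eq0 JA); apply/eqP.
  rewrite eq_le jaffard_norm_ge0 andbT.
  by have := jaffard_norm_le_nop JA; rewrite A0 mul0r.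
- move=> A B JA JB; apply: nop_le => [|C JC]; first by rewrite addr_ge0 ?nop_ge0.
  have := opmx_mulDl 1 JA JB JC; rewrite !scale1r => ->.
  apply: (le_trans (jaffard_normD (JM JA JC) (JM JB JC))).
  by rewrite mulrDl lerD ?nop_mul.
- move=> c A JA; apply/eqP; rewrite eq_le nopZ_le// andTb.
  have [->|c0] := eqVneq c 0; first by rewrite normr0 mul0r nop_ge0.
  have := nopZ_le c^-1 (jaffardZ c JA); rewrite scalerA mulVf// scale1r normfV.
  by rewrite Re_normV -ler_pdivlMl// Re_norm_gt0.
- move=> A B JA JB; apply: nop_le => [|C JC]; first by rewrite mulr_ge0 ?nop_ge0.
  rewrite -opmx_mulA// (le_trans (nop_mul JA (JM JB JC)))//.
  by rewrite -mulrA ler_wpM2l ?nop_ge0// nop_mul.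
- move=> u Ju uC.
  have o0 : 0 < nJ one + 1 by rewrite ltr_wpDl// jaffard_norm_ge0.
  have [|A JA uA] := jaffard_complete s_gt_d Ju.
    move=> e e0; have [|N NP] := uC (e / (nJ one + 1)); first by rewrite divr_gt0.
    exists N => m n Nm Nn.
    apply: (le_lt_trans (jaffard_norm_le_nop (jaffardB (Ju m) (Ju n)))).
    apply: (@le_lt_trans _ _ (nop (u m - u n) * (nJ one + 1))).
      by rewrite ler_wpM2l ?nop_ge0// lerDl.
    by rewrite -ltr_pdivlMr// NP.
  exists A => //; have [C C0 CP] := @jaffard_mul_bound R d X H s X_sep s_gt_d.
  apply/cvgrPdist_lt => /= e e0.
  have [|N NP] := uA (e / (2 * C)); first by rewrite divr_gt0// mulr_gt0.
  exists N => // n /= Nn; rewrite sub0r normrN ger0_norm ?nop_ge0//.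
  apply: (@le_lt_trans _ _ (C * (e / (2 * C)))).
    apply: (@le_trans _ _ (C * nJ (u n - A))); last by rewrite ler_wpM2l ?(ltW C0)// NP.
    apply: nop_le => [|B JB]; first by rewrite mulr_ge0 ?jaffard_norm_ge0// ltW.
    by have [] := CP _ B (jaffardB (Ju n) JA) JB.
  rewrite (_ : C * (e / (2 * C)) = e / 2); last by field; rewrite gt_eqF.
  lra.
Qed.

Lemma opnorm_op_mul A B : J A -> J B ->
  opnorm (op (opmx_mul A B)) <= opnorm (op A) * opnorm (op B).
Proof.
move=> JA JB; rewrite (opmx_mulE X_sep s_gt_d JA JB) op_entry; exact: opnorm_comp.
Qed.

(** By [jaffard_sqr_bound] the Jaffard norms of the iterated squares of A satisfy the
    recursion of [superlinear_decay], the operator norms of these squares being at most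
    rho^(2^n) with rho < 1; thus some iterated square has norm less than 1. *)
Lemma jaffard_one_sub_invertible A : J A -> opnorm (op A) < 1 ->
  invertible J (@opmx_mul R X H) one (one - A).
Proof.
move=> JA A1; have iba := jaffard_iba.
have [C C0 CP] := @jaffard_mul_bound R d X H s X_sep s_gt_d.
have [th thP [K K0 KP]] := @jaffard_sqr_bound R d X H s X_sep s_gt_d.
pose sq n := iter n (fun B => opmx_mul B B) A.
have Jsq n : J (sq n) by exact: (iter_sqr_J iba).
pose rho := (opnorm (op A) + 1) / 2.
have A0 : 0 <= opnorm (op A) := opnorm_ge0 _.
have rho0 : 0 < rho by rewrite /rho; lra.
have rho1 : rho < 1 by rewrite /rho; lra.
have osq n : opnorm (op (sq n)) <= expR (2 ^+ n * ln rho).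
  elim: n => [|n IH]; first by rewrite expr0 mul1r lnK ?posrE//= /rho; lra.
  apply: (le_trans (opnorm_op_mul (Jsq n) (Jsq n))).
  apply: (le_trans (ler_pM (opnorm_ge0 _) (opnorm_ge0 _) IH IH)).
  by rewrite -expRD exprS -mulrA -[2 in leRHS]/(1 + 1) mulrDl mul1r.
have Ci0 : 0 < C^-1 by rewrite invr_gt0.
have lr0 : ln rho < 0 by apply: ln_lt0; rewrite rho0 rho1.
have [n nP] := superlinear_decay thP K0 lr0 Ci0 (jaffard_norm_ge0 s (sq 0%N)) osq
  (fun n a b na nb b0 => KP (sq n) a b (Jsq n) na nb b0).
apply: (@iter_sqr_invertible _ _ _ _ _ _ _ iba A n JA).
apply: (@le_lt_trans _ _ (C * nJ (sq n))).
  apply: nop_le => [|B JB]; first by rewrite mulr_ge0 ?jaffard_norm_ge0// ltW.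
  by have [] := CP _ B (Jsq n) JB.
by rewrite mulrC -ltr_pdivlMr// div1r.
Qed.

(** For tau at most the inverse square of the norm of A*, expanding the square gives
    |g - tau A*A g|^2 <= |g|^2 - tau |A g|^2; so 1 - tau A*A is a strict contraction
    when A is bounded below. *)
Lemma star_mul_invertible A c : J A -> 0 < c ->
  (forall g : L, c * rnorm g <= rnorm (op A g)) ->
  invertible J (@opmx_mul R X H) one (opmx_mul (star A) A).
Proof.
move=> JA c0 Ac; have JsA := jaffard_star dot_norm JA.
set P := opmx_mul (star A) A; have JP : J P := JM JsA JA.
pose K := opnorm (op (star A)) + 1.
have K0 : 0 < K by rewrite ltr_wpDl// opnorm_ge0.
pose tau := K ^- 2; have tau0 : 0 < tau by rewrite invr_gt0 exprn_gt0.
have JtP : J (tau%:C *: P) := jaffardZ _ JP.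
have JE : J (one - tau%:C *: P) := jaffardB J1 JtP.
have opE g : op (one - tau%:C *: P) g = g + (- tau)%:C *: op P g.
  rewrite -scaleNr -rmorphN addrC (opL _ JP J1) op_one.
  by rewrite addrC.
have key g : rnorm (op (one - tau%:C *: P) g) ^+ 2 <= (1 - tau * c ^+ 2) * rnorm g ^+ 2.
  rewrite opE (rnorm_sqrD dot_norm) (opM JsA JA).
  rewrite -(rip_star X_sep s_gt_d dot_norm _ _ JA) (ripxx dot_norm).
  set u := op A g.
  have uK : rnorm (op (star A) u) ^+ 2 <= K ^+ 2 * rnorm u ^+ 2.
    rewrite -exprMn ler_pXn2r ?nnegrE ?mulr_ge0 ?rnorm_ge0 ?(ltW K0)//.
    apply: (le_trans (le_opnorm _ _)); rewrite ler_wpM2r ?rnorm_ge0//.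
    by rewrite lerDl.
  have cu : c ^+ 2 * rnorm g ^+ 2 <= rnorm u ^+ 2.
    rewrite -exprMn ler_pXn2r ?nnegrE ?mulr_ge0 ?rnorm_ge0 ?(ltW c0)//.
    exact: Ac.
  have : tau ^+ 2 * rnorm (op (star A) u) ^+ 2 <= tau * rnorm u ^+ 2.
    apply: (le_trans (ler_wpM2l (sqr_ge0 tau) uK)).
    rewrite le_eqVlt; apply/orP; left; apply/eqP; rewrite /tau; field.
    by rewrite gt_eqF.
  have := ler_wpM2l (ltW tau0) cu.
  rewrite sqrrN; move: (rnorm (op (star A) u) ^+ 2) (rnorm u ^+ 2) (rnorm g ^+ 2) => x y z.
  lra.
have : opnorm (op (one - tau%:C *: P)) < 1.
  apply: (@le_lt_trans _ _ (Num.sqrt (1 - tau * c ^+ 2))).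
    apply: opnorm_le_bound => [|g]; first exact: sqrtr_ge0.
    have [neg|pos] := ltP (1 - tau * c ^+ 2) 0.
      have : rnorm (op (one - tau%:C *: P) g) ^+ 2 <= 0.
        by apply: (le_trans (key g)); rewrite mulr_le0_ge0 ?sqr_ge0// ltW.
      rewrite exprn_even_le0//= => /eqP ->.
      by rewrite mulr_ge0 ?sqrtr_ge0 ?rnorm_ge0.
    rewrite -(ler_pXn2r (ltn0Sn 1)) ?nnegrE ?mulr_ge0 ?sqrtr_ge0 ?rnorm_ge0//.
    by rewrite exprMn (sqr_sqrtr pos); exact: key.
  rewrite -[ltRHS]sqrtr1 ltr_sqrt//.
  by rewrite gtrBl mulr_gt0// exprn_gt0.
move=> /(jaffard_one_sub_invertible JE)[B JB].
rewrite opprB addrC subrK => -[PB BP].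
have iba := jaffard_iba.
exists (tau%:C *: B); first exact: jaffardZ _ JB.
rewrite (opmx_mulZr _ JB JP) (opmx_mulZl _ JB JP).
by rewrite -{1}(opmx_mulZl _ JP JB) -(opmx_mulZr _ JP JB).
Qed.

(** An invertible A is bounded below, so that (A*A)^-1 A* exists in the Jaffard class
    and is a left inverse of A, hence its inverse. *)
Theorem jaffard_inverse_closed : inverse_closed J.
Proof.
move=> A JA; exists (op A) => [|S TS ST]; first exact: (opP X_sep s_gt_d JA).
have JsA := jaffard_star dot_norm JA.
pose c := (opnorm S + 1)^-1.
have S0 : 0 < opnorm S + 1 by rewrite ltr_wpDl// opnorm_ge0.
have [||B JB [_ BP]] := @star_mul_invertible A c JA.
- by rewrite invr_gt0.
- move=> g; rewrite mulrC ler_pdivrMr// -[g in leLHS]TS.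
  apply: (le_trans (le_opnorm _ _)); rewrite mulrC ler_wpM2l ?rnorm_ge0//.
  by rewrite lerDl.
have JBA : J (opmx_mul B (star A)) := JM JB JsA.
exists (opmx_mul B (star A)) => //.
suff -> : S = op (opmx_mul B (star A)) by exact: (opP X_sep s_gt_d JBA).
apply: eq_bop => g; rewrite -[g in RHS]ST -(opM JBA JA).
by rewrite -(opmx_mulA JB JsA JA) BP op_one.
Qed.

(** If B inverts Q* Q = Q Q*, then B Q* and Q* B are a left and a right inverse of Q. *)
Lemma normal_invertible Q c : J Q -> opmx_mul (star Q) Q = opmx_mul Q (star Q) ->
  0 < c -> (forall g : L, c * rnorm g <= rnorm (op Q g)) ->
  invertible J (@opmx_mul R X H) one Q.
Proof.
move=> JQ QQ c0 Qc; have JsQ := jaffard_star dot_norm JQ.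
have [B JB [PB BP]] := star_mul_invertible JQ c0 Qc.
apply: (@left_right_inverse _ _ _ _ _ _ _ jaffard_iba _
  (opmx_mul B (star Q)) (opmx_mul (star Q) B) JQ (JM JB JsQ) (JM JsQ JB)).
  by rewrite -(opmx_mulA JB JsQ JQ).
by rewrite (opmx_mulA JQ JsQ JB) -QQ.
Qed.

(** Let P = A*A and z = a + ib. Since <P g, g> = |A g|^2 is real,
    |(P - z) g|^2 = |P g|^2 - 2a |A g|^2 + (a^2 + b^2) |g|^2.
    If b <> 0 this is |(P - a) g|^2 + b^2 |g|^2; if b = 0 and a < 0 it is at least
    a^2 |g|^2. Either way the normal element P - z is bounded below. *)
Lemma spectrum_star_mul A : J A ->
  spectrum J (@opmx_mul R X H) one (opmx_mul (star A) A) `<=` [set z | 0 <= z].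
Proof.
move=> JA z /= zP; have JsA := jaffard_star dot_norm JA.
set P := opmx_mul (star A) A in zP *; have JP : J P := JM JsA JA.
have PE g : op P g = op (star A) (op A g) by exact: opM.
have sP : star P = P.
  by rewrite (star_mul X_sep s_gt_d dot_norm JsA JA) (starK dot_norm).
clearbody P; pose Q w := P - w *: one.
have {}zP : ~ invertible J (@opmx_mul R X H) one (Q z) := spectrum_not_invertible zP.
have JQ w : J (Q w) := jaffardB JP (jaffardZ w J1).
have opQ w g : op (Q w) g = op P g - w *: g.
  by rewrite /Q addrC -scaleNr (opL _ J1 JP) op_one addrC scaleNr.
have sQ w : star (Q w) = Q w^*.
  rewrite /Q addrC -scaleNr (star_lin dot_norm) sP (star_one X_sep s_gt_d dot_norm).
  by rewrite rmorphN scaleNr addrC.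
clearbody Q.
have QC v w : opmx_mul (Q v) (Q w) = opmx_mul (Q w) (Q v).
  apply: (jaffard_ext (JM (JQ v) (JQ w)) (JM (JQ w) (JQ v))) => g.
  by rewrite (opM (JQ v) (JQ w)) (opM (JQ w) (JQ v)) !opQ bop_shift_comm.
have QQ w : opmx_mul (star (Q w)) (Q w) = opmx_mul (Q w) (star (Q w)) by rewrite sQ QC.
case: z zP => a b; set z := a +i* b => zP.
have key g : rnorm (op (Q z) g) ^+ 2 =
    rnorm (op P g) ^+ 2 - 2 * a * rnorm (op A g) ^+ 2 + (a ^+ 2 + b ^+ 2) * rnorm g ^+ 2.
  have zg : z *: g = a%:C *: g + b%:C *: ('i%C *: g).
    by rewrite scalerA -scalerDl; congr (_ *: _); rewrite /z; simpc.
  have Pg h : rip (op P g) h = rip (op A g) (op A h).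
    rewrite PE ripC -(rip_star X_sep s_gt_d dot_norm _ _ JA).
    exact: ripC.
  have ig (h : L) : rip h ('i%C *: h) = 0.
    have := rip_skew dot_norm h h; rewrite ripC; lra.
  have ni : rnorm ('i%C *: g) = rnorm g.
    by rewrite rnormZ normc_def /= expr0n expr1n add0r sqrtr1 mul1r.
  rewrite opQ zg opprD addrA -[- (a%:C *: g)]scaleNr -[- (b%:C *: _)]scaleNr -!rmorphN.
  have r0 : rip (op P g + (- a)%:C *: g) ('i%C *: g) = 0.
    rewrite (ripDl dot_norm (op P g)) (ripZl dot_norm _ g) (ig g) mulr0 addr0.
    by rewrite (Pg ('i%C *: g)) (bopZ (op A)) (ig (op A g)).
  rewrite (rnorm_sqrD dot_norm (op P g + _)) r0 ni (rnorm_sqrD dot_norm (op P g)) (Pg g).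
  rewrite (ripxx dot_norm).
  by move: (rnorm (op P g)) (rnorm (op A g)) (rnorm g) => x y w; ring.
case: (boolP (0 <= z)) => // z0; exfalso; apply: zP.
have [b0|b0] := eqVneq b 0.
  have a0 : a < 0.
    by rewrite ltNge; apply: contra z0 => a0; rewrite /z b0 lecE /= eqxx.
  apply: (@normal_invertible _ (- a) (JQ z) (QQ z)); first lra.
  have Na0 : 0 <= - a by rewrite oppr_ge0 ltW.
  move=> g; rewrite -(ler_pXn2r (ltn0Sn 1)) ?nnegrE ?mulr_ge0 ?rnorm_ge0//.
  rewrite key b0; move: (rnorm (op P g)) (rnorm (op A g)) (rnorm g) => x y w.
  have := mulr_ge0 Na0 (sqr_ge0 y); have := sqr_ge0 x; lra.
apply: (@normal_invertible _ `|b| (JQ z) (QQ z)); first by rewrite normr_gt0.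
move=> g; rewrite -(ler_pXn2r (ltn0Sn 1)) ?nnegrE ?mulr_ge0 ?rnorm_ge0//.
rewrite key exprMn real_normK ?num_real// -subr_ge0.
have Pg : rip (op P g) g = rnorm (op A g) ^+ 2.
  rewrite PE ripC -(rip_star X_sep s_gt_d dot_norm _ _ JA).
  exact: (ripxx dot_norm).
rewrite (_ : _ - _ = rnorm (op P g + (- a)%:C *: g) ^+ 2); first exact: sqr_ge0.
rewrite (rnorm_sqrD dot_norm (op P g) g (- a)) Pg.
by move: (rnorm (op P g)) (rnorm (op A g)) (rnorm g) => x y w; ring.
Qed.

End jaffard_banach_algebra.

Theorem mainTheorem1 (R : realType) (d : nat) (X : set 'rV[R]_d)
    (H : completeNormedModType R[i]) (dot : {dot H for Num.conj})
    (dot_norm : forall x : H, `|x| ^+ 2 = dot x x)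
    (X_sep : relatively_separated X) (s : R) (s_gt_d : d%:R < s) :
  inverse_closed (jaffard X H s) /\
  symmetric_banach_algebra (jaffard X H s) (@opmx_mul R X H) (opmx_one X H)
    (opmx_star dot) (@jaffard_opnorm R d X H s).
Proof.
split; first exact: (jaffard_inverse_closed dot_norm X_sep s_gt_d).
split; first exact: jaffard_iba.
exact: spectrum_star_mul.
Qed.
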